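(* Let $n\geq3$, $m\geq1$ be integers and let $f=h+F\in\mathbb{C}\llbracket x_1,\dots,x_n\rrbracket$ be semihomogeneous of degree $d$ with initial form $h$. For $p\in\mathbb{Z}$ put $\rho=-p$ and let $F_{(p)}\mathcal{X}_m$ be the set of jets of order $\rho$ in the restricted $m$-contact locus $\mathcal{X}_m$ of $f$. Then: (i) If $p\notin[-m/d,-1]\cap\mathbb{Z}$, then $F_{(p)}\mathcal{X}_m=\varnothing$. Otherwise, (ii)–(iv) hold. (ii) For $p\in[-m/d,-1]\cap\mathbb{Z}$ and $\gamma\in F_{(p)}\mathcal{X}_m$, the variables $\gamma_0,\dots,\gamma_{\rho-1}$ are zero and the variables $\gamma_{m-(d-1)\rho+1},\dots,\gamma_m$ are not subject to any equation; formally, $$\pi^m_{\rho-1}(F_{(p)}\mathcal{X}_m)=\{0\},\qquad F_{(p)}\mathcal{X}_m=(\pi^m_{m-(d-1)\rho})^{-1}\big(\pi^m_{m-(d-1)\rho}(F_{(p)}\mathcal{X}_m)\big).$$ (iii) The variable $\gamma_\rho$ is only constrained by one equation, namely $h(\gamma_\rho)=0$ if $p\in(-m/d,-1]$ and $h(\gamma_\rho)=1$ if $p=-m/d$; formally (via the coordinate $\gamma_\rho$), $$\pi^m_\rho(F_{(p)}\mathcal{X}_m)\cong\begin{cases}CS^\circ&\text{if }-m/d<p\leq-1,\\ M_h&\text{if }d\mid m\text{ and }p=-m/d,\end{cases}$$ where $CS^\circ=\{x\in\mathbb{C}^n:h(x)=0\}\setminus\{0\}$ and $M_h=\{x\in\mathbb{C}^n:h(x)=1\}$.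 (iv) For $a\in[\rho+1,m-(d-1)\rho]\cap\mathbb{Z}$, the variable $\gamma_a$ is restricted to a hyperplane depending holomorphically on the lower-order variables, which after translation to the origin is the tangent hyperplane of $\pi^m_\rho(F_{(p)}\mathcal{X}_m)$ at $\gamma_\rho$; formally, the restricted truncation map $$\pi^a_{a-1}:\pi^m_a(F_{(p)}\mathcal{X}_m)\to\pi^m_{a-1}(F_{(p)}\mathcal{X}_m)$$ is a complex affine bundle whose model vector bundle is the pullback by $\pi^{a-1}_\rho$ of the tangent bundle of $\pi^m_\rho(F_{(p)}\mathcal{X}_m)$.
   Context: Semihomogeneous of degree $d$: $f=h+F$ where $h$ is a homogeneous polynomial of degree $d$ having $0$ as an isolated critical point and $F$ is a power series of order $>d$. $\mathcal{L}_m\cong\mathbb{C}^{n(m+1)}$ is the space of $m$-jets $\gamma(t)=\sum_{j=0}^m\gamma_jt^j$, $\gamma_j\in\mathbb{C}^n$, in $\mathbb{C}^n$; $\pi^m_{m'}:\mathcal{L}_m\to\mathcal{L}_{m'}$ ($m'\leq m$) is truncation modulo $t^{m'+1}$; $\mathrm{ord}_t(\gamma)=\min\{j:\gamma_j\neq0\}$. The restricted contact locus is $\mathcal{X}_m=\{\gamma\in\mathcal{L}_m:\gamma(0)=0,\ f(\gamma(t))\equiv t^m\pmod{t^{m+1}}\}$, and $F_{(p)}\mathcal{X}_m=\{\gamma\in\mathcal{X}_m:\mathrm{ord}_t(\gamma)=-p\}$. *)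

(* Defs.v *)
From HB Require Import structures.
From mathcomp Require Import all_boot all_order all_algebra.
(* mpoly has to be imported before MathComp-Analysis: in the other order, their
   notations clash. *)
From mathcomp Require Import complex mpoly.
From mathcomp Require Import all_classical all_reals all_analysis.

Set Implicit Arguments.
Unset Strict Implicit.
Unset Printing Implicit Defensive.

Import Order.TTheory GRing.Theory Num.Theory.
Import numFieldNormedType.Exports.

Local Open Scope classical_set_scope.
Local Open Scope ring_scope.

(* Everything is stated over a [numClosedFieldType] [K], whose standard topology
   is available from its sort; the intended instance is [K := R[i]] with
   [R : realType].  Over such a [K], [differentiable] means complex
   differentiable, i.e. holomorphic when it holds on an open set. *)

Section Holomorphic.
Context {K : numClosedFieldType}.

(* Holomorphy of a map on a subset [A] of its domain: locally the restriction to
   [A] of a holomorphic map of the ambient space. *)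
Definition holomorphic_on {V W : normedModType K} (A : set V) (f : V -> W) :=
  forall x, A x -> exists g : V -> W,
    \forall y \near x, differentiable g y /\ (A y -> g y = f y).

Definition biholomorphism {V W : normedModType K} (A : set V) (B : set W)
    (f : V -> W) :=
  exists g : W -> V,
    [/\ holomorphic_on A f,
        holomorphic_on B g,
        (forall x, A x -> B (f x) /\ g (f x) = x) &
        (forall y, B y -> A (g y) /\ f (g y) = y)].

(* Velocities at [x] of germs of holomorphic curves lying in [X]; for a complex
   submanifold this is the holomorphic tangent space. *)
Definition tangent_space {V : normedModType K} (X : set V) (x : V) : set V :=
  [set v | exists c : K^o -> V,
    [/\ (\forall z \near (0 : K^o), differentiable c z /\ X (c z)),
        c 0 = x & is_derive (0 : K^o) 1 c v]].

Definition tangent_bundle {V : normedModType K} (X : set V) : set (V * V) :=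
  [set xv | X xv.1 /\ tangent_space X xv.1 xv.2].

(* Families of subspaces of a fixed [W] over a base [B] are represented by their
   total space, a subset of [WB * W]. *)
Definition pullback_bundle {WB V W : normedModType K} (B : set WB)
    (g : WB -> V) (M : set (V * W)) : set (WB * W) :=
  [set bv | B bv.1 /\ M (g bv.1, bv.2)].

(* A trivialization over [U] of the rank [r] vector bundle [M] over [B]. *)
Definition vector_trivialization {WB W : normedModType K} (r : nat)
    (B U : set WB) (M : set (WB * W)) (psi : WB -> 'rV[K]_r -> W) :=
  biholomorphism ((B `&` U) `*` [set: 'rV[K]_r])
                 (M `&` [set bv | U bv.1])
                 (fun bz => (bz.1, psi bz.1 bz.2)) /\
  (forall b, (B `&` U) b -> linear (psi b)).

(* [pr : E -> B] is a holomorphic affine bundle of rank [r] whose model is the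
   vector bundle [M -> B], where [act e v] is the translate of the point [e] of
   the fibre of [E] over [b] by the vector [v] of the fibre of [M] over [b]:
   locally on [B] there are compatible trivializations [phi] of [E] and [psi] of
   [M], such that [phi b] is an affine map with linear part [psi b]. *)
Definition affine_bundle {WE WB W : normedModType K} (r : nat)
    (E : set WE) (B : set WB) (pr : WE -> WB) (M : set (WB * W))
    (act : WE -> W -> WE) :=
  [/\ holomorphic_on E pr,
      pr @` E = B,
      (forall b v, M (b, v) -> B b) &
      forall b0, B b0 ->
      exists U : set WB, exists phi : WB -> 'rV[K]_r -> WE,
      exists psi : WB -> 'rV[K]_r -> W,
        [/\ open U /\ U b0,
            biholomorphism ((B `&` U) `*` [set: 'rV[K]_r])
                           (E `&` pr @^-1` U)
                           (fun bz => phi bz.1 bz.2),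
            (forall b y, (B `&` U) b -> pr (phi b y) = b),
            vector_trivialization B U M psi &
            (forall b y z, (B `&` U) b ->
               phi b (y + z) = act (phi b y) (psi b z))]].

End Holomorphic.

Section Semihomogeneous.
Context {K : numClosedFieldType} {n : nat}.

(* Formal power series in [n] variables, as families of coefficients. *)
Definition power_series := 'X_{1..n} -> K.

Definition eval_mpoly (h : {mpoly K[n]}) (x : 'rV[K]_n) : K :=
  h.@[fun i => x 0 i].

Definition critical_point (h : {mpoly K[n]}) (x : 'rV[K]_n) :=
  forall i : 'I_n, eval_mpoly h^`M(i) x = 0.

Definition isolated_critical_point (h : {mpoly K[n]}) (x : 'rV[K]_n) :=
  critical_point h x /\ \forall y \near x^', ~ critical_point h y.

Definition semihomogeneous (d : nat) (h : {mpoly K[n]}) (f : power_series) :=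
  [/\ h \is d.-homog,
      isolated_critical_point h 0 &
      exists F : power_series,
        (forall al, (mdeg al <= d)%N -> F al = 0) /\
        (forall al, f al = h@_al + F al)].

Definition cone_minus_origin (h : {mpoly K[n]}) : set 'rV[K]_n :=
  [set x | eval_mpoly h x = 0] `\ 0.

Definition milnor_fiber (h : {mpoly K[n]}) : set 'rV[K]_n :=
  [set x | eval_mpoly h x = 1].

End Semihomogeneous.

Arguments power_series : clear implicits.

Section Jets.
Context {K : numClosedFieldType} {n : nat}.

(* The space of [m]-jets is ['M[K]_(m.+1, n)]: row [j] of [g] is the coefficient
   of [t ^ j]. *)

(* Meaningful for [m' <= m]. *)
Definition truncation {m : nat} (m' : nat) (g : 'M[K]_(m.+1, n)) :
    'M[K]_(m'.+1, n) :=
  \matrix_(j < m'.+1, i < n) g (inord j) i.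

Definition is_jet_order {m : nat} (g : 'M[K]_(m.+1, n)) (j : 'I_m.+1) :=
  row j g != 0 /\ forall k : 'I_m.+1, (k < j)%N -> row k g = 0.

Definition jet_poly {m : nat} (g : 'M[K]_(m.+1, n)) (i : 'I_n) : {poly K} :=
  \poly_(j < m.+1) g (inord j) i.

(* [f (g t)] modulo [t ^ m.+1], for a jet [g] with [g 0 = 0]: the monomials of
   degree larger than [m] then do not contribute. *)
Definition series_at_jet {m : nat} (f : power_series K n)
    (g : 'M[K]_(m.+1, n)) : {poly K} :=
  \sum_(al : 'X_{1..n < m.+1})
    f al *: \prod_(i < n) jet_poly g i ^+ al i.

Definition contact_locus (f : power_series K n) (m : nat) :
    set 'M[K]_(m.+1, n) :=
  [set g | row ord0 g = 0 /\ 'X^(m.+1) %| series_at_jet f g - 'X^m].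

Arguments contact_locus f m _ : clear implicits.

(* The zero jet, whose order is infinite, belongs to no [contact_stratum]. *)
Definition contact_stratum (f : power_series K n) (m : nat) (p : int) :
    set 'M[K]_(m.+1, n) :=
  [set g | contact_locus f m g /\
           exists j : 'I_m.+1, is_jet_order g j /\ Posz j = - p].

(* Translation of the top coefficient of the [a]-jet [g] by the top coefficient
   of [v]. *)
Definition translate_top {a r : nat} (g : 'M[K]_(a.+1, n))
    (v : 'M[K]_(r.+1, n)) : 'M[K]_(a.+1, n) :=
  g + \matrix_(j < a.+1, i < n) (if j == ord_max then v ord_max i else 0).

End Jets.

Arguments contact_locus {K n} f m _.
Arguments contact_stratum {K n} f m p _.

(* Main.v *)
Require Import Defs.
From HB Require Import structures.
From mathcomp Require Import all_boot all_order all_algebra.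
From mathcomp Require Import complex mpoly.
From mathcomp Require Import all_classical all_reals all_analysis.
From mathcomp Require Import ring zify.

(* Along a jet of order [rho], the coefficient of [t ^ (d rho)] in [f (g t)] is
   [h (g_rho)], and for [a > rho] the coefficient of [t ^ ((d - 1) rho + a)] is
   the differential of [h] at [g_rho] applied to [g_a], plus a polynomial in the
   coefficients of lower order.  As [0] is the only critical point of the
   homogeneous polynomial [h], these differentials are nonzero, so the equations
   are solved one coefficient after the other, and where a partial derivative of
   [h] does not vanish the corresponding coordinate of [g_a] can be eliminated,
   which gives the trivializations.

   That the kernel of the differential is the space of velocities of holomorphic
   curves in a level set of [h] needs an implicit function in one variable: the
   small root [w] of the polynomial [h (x + z v + w e_i) - h x] exists because the
   field is algebraically closed, and the divided differences of [h] make it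
   unique, continuous and differentiable in [z]. *)

Import Order.TTheory GRing.Theory Num.Theory.
Import numFieldNormedType.Exports.
Local Open Scope classical_set_scope.
Local Open Scope ring_scope.

Set Implicit Arguments.
Unset Strict Implicit.
Unset Printing Implicit Defensive.

(** * First order expansion of polynomials *)

(** All equations are kept in the one space of [m]-jets: a truncated stratum is described by
    [m]-jets that satisfy only the equations of index at most [(d - 1) rho + a], which see no
    coefficient beyond [a]. Each further equation can be solved, so truncating the stratum adds no
    hidden condition, and the free coefficients begin where [(d - 1) rho + a] passes [m]. Two inputs
    come from homogeneity and not from this recursion. A critical point off the origin would carry
    its whole line with it, hence critical points arbitrarily near [0]; a similar scaling gives
    [d >= 2]. The strata are also shown to be nonempty, as otherwise the truncation to order
    [rho - 1] would be empty instead of [{0}]; this is where a zero of [h] off the origin and a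
    point with [h = 1] are produced. The lemmas are proved over a closed normed field that is not
    assumed complete, so the implicit function cannot be the limit of an iteration: its existence is
    algebraic, and the norm only serves to compare solutions. *)

Lemma mpoly_ring_ind (n : nat) (K : comNzRingType) (P : {mpoly K[n]} -> Prop) :
  (forall c, P c%:MP) -> (forall i, P 'X_i) ->
  (forall p q, P p -> P q -> P (p + q)) ->
  (forall p q, P p -> P q -> P (p * q)) -> forall p, P p.
Proof.
move=> PC PX PD PM p; rewrite [p]mpolyE.
apply: (big_ind P) => [||m _]; [by rewrite -mpolyC0|exact: PD|].
rewrite -mul_mpolyC; apply: (PM) => //; rewrite mpolyXE_id.
have P1 : P 1 by rewrite -mpolyC1.
apply: (big_ind P) => [||i _]; [exact: P1|exact: PM|].
by elim: (m i) => [|k IH]; rewrite ?expr0 ?exprS //; apply: PM.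
Qed.

(** The target ring is arbitrary because the expansion is used with [u] a power of [t] in a
    polynomial ring, where all that matters about the remainder is its factor [u ^+ 2]. Products are
    handled by the Leibniz rule. *)
Lemma mmap_taylor1 (n : nat) (K A : comNzRingType) (f : {rmorphism K -> A})
    (x e : 'I_n -> A) (u : A) (p : {mpoly K[n]}) :
  exists r, mmap f (fun i => x i + u * e i) p =
    mmap f x p + u * (\sum_i e i * mmap f x p^`M(i)) + u ^+ 2 * r.
Proof.
elim/mpoly_ring_ind: p => [c|i|p q [r Er] [s Es]|p q [r Er] [s Es]].
- exists 0; rewrite !mmapC big1 ?mulr0 ?addr0 // => i _.
  by rewrite mderivC mmap0 mulr0.
- exists 0; rewrite !mmapX !mmap1U mulr0 addr0 (bigD1 i) //= big1 ?addr0.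
    by rewrite mderivX mnm1E eqxx scale1r -{1}[U_(i)%MM]add0m addmK mmapX mmap11 mulr1.
  move=> j ji; rewrite mderivX mnm1E eq_sym (negPf ji) scale0r mmap0 mulr0 //.
- exists (r + s); rewrite !mmapD Er Es.
  under [in RHS]eq_bigr => i _ do rewrite mderivD mmapD mulrDr.
  by rewrite big_split /=; ring.
set P := mmap f x p in Er *; set Q := mmap f x q in Es *.
set dP := \sum_i _ in Er; set dQ := \sum_i _ in Es.
exists (dP * dQ + P * s + r * Q + u * (dP * s + r * dQ) + u ^+ 2 * r * s).
rewrite !rmorphM /= Er Es -/P -/Q.
have -> : \sum_i e i * mmap f x (p * q)^`M(i) = dP * Q + P * dQ.
  rewrite mulr_suml mulr_sumr -big_split; apply: eq_bigr => i _ /=.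
  by rewrite mderivM mmapD !rmorphM /= -/P -/Q; ring.
by ring.
Qed.

Lemma mmap_dhomog (n d : nat) (K A : comNzRingType) (f : {rmorphism K -> A})
    (x : 'I_n -> A) (c : A) (p : {mpoly K[n]}) :
  p \is d.-homog -> mmap f (fun i => c * x i) p = c ^+ d * mmap f x p.
Proof.
move=> /dhomogP pd; rewrite /mmap mulr_sumr big_seq [RHS]big_seq.
apply: eq_bigr => m /pd <-; rewrite /= mulrCA; congr (_ * _).
rewrite /mmap1 mdegE expr_sum -big_split /=; apply: eq_bigr => i _.
by rewrite exprMn.
Qed.

(** Monomial by monomial, homogeneity pulls out [c ^+ mdeg m] and the first order expansion pulls
    out [u]. With [c = t ^ rho], [k = d + 1] and [u = t ^ (a - rho)] the change starts at index
    [d rho + a]. *)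
Lemma mmap_increment_order (n k : nat) (K A : comNzRingType)
    (f : {rmorphism K -> A}) (x e : 'I_n -> A) (c u : A) (p : {mpoly K[n]}) :
  (forall m, m \in msupp p -> (k <= mdeg m)%N) ->
  exists r, mmap f (fun i => c * (x i + u * e i)) p =
    mmap f (fun i => c * x i) p + c ^+ k * u * r.
Proof.
move=> pk; rewrite [p]mpolyE big_seq.
elim/big_ind: (\sum_(i <- msupp p | _) _) => [|p1 p2 [r1 E1] [r2 E2]|m /pk km].
- by exists 0; rewrite !mmap0 mulr0 addr0.
- by exists (r1 + r2); rewrite !mmapD E1 E2; ring.
have Xm : 'X_[m] \is [in K[n], (mdeg m).-homog] by rewrite dhomogX.
have [r Er] := mmap_taylor1 f x e u 'X_[m].
exists (f p@_m * c ^+ (mdeg m - k) * ((\sum_i e i * mmap f x ('X_[m])^`M(i)) + u * r)).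
rewrite !mmapZ (mmap_dhomog _ _ _ Xm) (mmap_dhomog _ _ _ Xm) Er.
by rewrite -(subnKC km) exprD addKn; ring.
Qed.

Lemma mmap_order (n k : nat) (K A : comNzRingType)
    (f : {rmorphism K -> A}) (x : 'I_n -> A) (c : A) (p : {mpoly K[n]}) :
  (forall m, m \in msupp p -> (k <= mdeg m)%N) ->
  exists r, mmap f (fun i => c * x i) p = c ^+ k * r.
Proof.
move=> pk; rewrite [p]mpolyE big_seq.
elim/big_ind: (\sum_(i <- msupp p | _) _) => [|p1 p2 [r1 E1] [r2 E2]|m /pk km].
- by exists 0; rewrite !mmap0 mulr0.
- by exists (r1 + r2); rewrite !mmapD E1 E2; ring.
have Xm : 'X_[m] \is [in K[n], (mdeg m).-homog] by rewrite dhomogX.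
exists (f p@_m * c ^+ (mdeg m - k) * mmap f x 'X_[m]).
rewrite !mmapZ (mmap_dhomog _ _ _ Xm).
by rewrite -{1}(subnKC km) exprD; ring.
Qed.

(** * Coefficients of a series along a jet *)

Lemma rmorph_mmap (n : nat) (K A B : comNzRingType) (f : {rmorphism K -> A})
    (g : {rmorphism A -> B}) (x : 'I_n -> A) (p : {mpoly K[n]}) :
  g (mmap f x p) = mmap (g \o f) (g \o x) p.
Proof.
rewrite /mmap rmorph_sum; apply: eq_bigr => al _.
rewrite rmorphM /mmap1 rmorph_prod; congr (_ * _).
by apply: eq_bigr => i _; rewrite rmorphXn.
Qed.

Lemma coef0_mmap_polyC (n : nat) (K : comNzRingType) (x : 'I_n -> {poly K})
    (p : {mpoly K[n]}) :
  (mmap polyC x p)`_0 = p.@[fun i => (x i)`_0].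
Proof.
rewrite -horner_coef0 -[_.[0]]/(horner_eval 0 _) rmorph_mmap /meval.
rewrite /mmap; apply: eq_bigr => al _; rewrite /= /horner_eval hornerC.
congr (_ * _); apply: eq_bigr => i _ /=.
by rewrite /horner_eval horner_coef0.
Qed.

(** A genuine polynomial that gives the same [series_at_jet] as [f], so that homogeneity and Taylor
    expansion apply to it. *)
Definition truncated_series {K : numClosedFieldType} {n : nat} (m : nat)
    (f : power_series K n) : {mpoly K[n]} :=
  \sum_(al : 'X_{1..n < m.+1}) f al *: 'X_[al].

(** Total in [j], with value zero beyond [m], so that jets of different lengths are compared
    coefficient by coefficient without casting ordinals. *)
Definition jet_coef {K : numClosedFieldType} {n m : nat}
    (g : 'M[K]_(m.+1, n)) (j : nat) : 'rV[K]_n :=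
  \row_i (jet_poly g i)`_j.

Definition jet_extension {K : numClosedFieldType} {n a : nat} (m : nat)
    (g : 'M[K]_(a.+1, n)) : 'M[K]_(m.+1, n) :=
  \matrix_(j < m.+1, i < n) jet_coef g j 0 i.

Definition differential_form {K : numClosedFieldType} {n : nat}
    (h : {mpoly K[n]}) (x v : 'rV[K]_n) : K :=
  \sum_i v 0 i * eval_mpoly h^`M(i) x.

Section JetCoefficients.
Context {K : numClosedFieldType} {n : nat}.

Lemma mcoeff_truncated_series m (f : power_series K n) al :
  (truncated_series m f)@_al = if (mdeg al <= m)%N then f al else 0.
Proof.
rewrite /truncated_series raddf_sum /=; case: ifPn => [le|gt].
  have lt : (mdeg al < m.+1)%N by [].
  rewrite (bigD1 (BMultinom lt)) //= mcoeffZ mcoeffX eqxx mulr1 big1 ?addr0 //.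
  move=> be nbe; rewrite mcoeffZ mcoeffX; case: eqP => [E|]; last by rewrite mulr0.
  by case/eqP: nbe; apply: val_inj.
rewrite big1 // => be _; rewrite mcoeffZ mcoeffX; case: eqP => [E|].
  by case/negP: gt; rewrite -E -ltnS bmdeg.
by rewrite mulr0.
Qed.

Lemma series_at_jetE m (f : power_series K n) (g : 'M[K]_(m.+1, n)) :
  series_at_jet f g = mmap polyC (jet_poly g) (truncated_series m f).
Proof.
rewrite /series_at_jet /truncated_series raddf_sum /=; apply: eq_bigr => al _.
by rewrite mmapZ mmapX mul_polyC.
Qed.

Lemma jet_coefE m (g : 'M[K]_(m.+1, n)) j :
  jet_coef g j = if (j <= m)%N then row (inord j) g else 0.
Proof.
by apply/rowP => i; rewrite !mxE coef_poly ltnS; case: ifP; rewrite !mxE.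
Qed.

Lemma jet_coef_ord m (g : 'M[K]_(m.+1, n)) (j : 'I_m.+1) :
  jet_coef g j = row j g.
Proof. by rewrite jet_coefE -ltnS ltn_ord inord_val. Qed.

Lemma jet_coef_gt m (g : 'M[K]_(m.+1, n)) j : (m < j)%N -> jet_coef g j = 0.
Proof. by move=> mj; rewrite jet_coefE leqNgt mj. Qed.

Lemma coef_jet_poly m (g : 'M[K]_(m.+1, n)) i j :
  (jet_poly g i)`_j = jet_coef g j 0 i.
Proof. by rewrite mxE. Qed.

Lemma jet_coefP m (g g' : 'M[K]_(m.+1, n)) :
  (forall j, (j <= m)%N -> jet_coef g j = jet_coef g' j) -> g = g'.
Proof.
move=> E; apply/row_matrixP => j; rewrite -!jet_coef_ord.
by apply: E; rewrite -ltnS ltn_ord.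
Qed.

Lemma jet_coef_truncation m a (g : 'M[K]_(m.+1, n)) j : (a <= m)%N ->
  jet_coef (truncation a g) j = if (j <= a)%N then jet_coef g j else 0.
Proof.
move=> am; rewrite !jet_coefE; case: ifP => // ja.
rewrite (leq_trans ja am); apply/rowP => i; rewrite !mxE.
by rewrite inordK.
Qed.

Lemma jet_coef_extension m a (g : 'M[K]_(a.+1, n)) j :
  jet_coef (jet_extension m g) j = if (j <= m)%N then jet_coef g j else 0.
Proof.
rewrite jet_coefE; case: ifP => // jm; apply/rowP => i.
by rewrite !mxE inordK.
Qed.

Lemma jet_coefD m (g g' : 'M[K]_(m.+1, n)) j :
  jet_coef (g + g') j = jet_coef g j + jet_coef g' j.
Proof.
by rewrite !jet_coefE; case: ifP => _; rewrite ?addr0 //; apply/rowP => i; rewrite !mxE.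
Qed.

Lemma truncationK m a b (g : 'M[K]_(m.+1, n)) : (b <= a)%N -> (a <= m)%N ->
  truncation b (truncation a g) = truncation b g.
Proof.
move=> ba am; apply: jet_coefP => j jb.
by rewrite !jet_coef_truncation ?(leq_trans ba am) // jb (leq_trans jb ba).
Qed.

Lemma jet_poly_divXn m (g : 'M[K]_(m.+1, n)) k :
  (forall j, (j < k)%N -> jet_coef g j = 0) ->
  exists P : 'I_n -> {poly K}, [/\ jet_poly g = (fun i => 'X^k * P i)
    & forall i, (P i)`_0 = jet_coef g k 0 i].
Proof.
move=> g0; exists (fun i => drop_poly k (jet_poly g i)); split=> [|i].
  apply/funext => i; rewrite -[LHS](poly_take_drop k) mulrC.
  suff -> : take_poly k (jet_poly g i) = 0 by rewrite add0r.
  apply/polyP => j; rewrite coef_take_poly coef0; case: ifP => // jk.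
  by rewrite coef_jet_poly g0 // mxE.
by rewrite coef_drop_poly add0n coef_jet_poly.
Qed.

Lemma jet_poly_increment m (g g' : 'M[K]_(m.+1, n)) k :
  (forall j, (j < k)%N -> jet_coef g j = jet_coef g' j) ->
  exists E : 'I_n -> {poly K}, [/\ forall i, jet_poly g' i = jet_poly g i + 'X^k * E i
    & forall i, (E i)`_0 = jet_coef g' k 0 i - jet_coef g k 0 i].
Proof.
move=> gg'; exists (fun i => drop_poly k (jet_poly g' i - jet_poly g i)); split=> i.
  set D := _ - _; rewrite mulrC.
  suff T0 : take_poly k D = 0.
    by rewrite -[drop_poly _ _ * _]add0r -{1}T0 poly_take_drop addrC subrK.
  apply/polyP => j; rewrite coef_take_poly coef0; case: ifP => // jk.
  by rewrite coefB !coef_jet_poly gg' // subrr.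
by rewrite coef_drop_poly add0n coefB !coef_jet_poly.
Qed.

Section SeriesAtJet.
Context (d m : nat) (h : {mpoly K[n]}) (f F : power_series K n).
Context (h_homog : h \is d.-homog).
Context (F0 : forall al, (mdeg al <= d)%N -> F al = 0).
Context (fE : forall al, f al = h@_al + F al).

Lemma msupp_truncated_series al :
  al \in msupp (truncated_series m f) -> (d <= mdeg al)%N.
Proof.
rewrite mcoeff_msupp mcoeff_truncated_series; apply: contra_neqT.
rewrite -ltnNge => lt; case: ifP => // _; rewrite fE F0 1?ltnW // addr0.
by rewrite (dhomog_nemf_coeff h_homog) // ltn_eqF.
Qed.

Lemma msupp_truncated_series_sub_initial al : (d <= m)%N ->
  al \in msupp (truncated_series m f - h) -> (d.+1 <= mdeg al)%N.
Proof.
move=> dm; rewrite mcoeff_msupp mcoeffB mcoeff_truncated_series; apply: contra_neqT.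
rewrite -ltnNge ltnS => le; rewrite (leq_trans le dm) fE F0 // addr0 subrr //.
Qed.

Lemma coef_series_lt rho (g : 'M[K]_(m.+1, n)) j :
  (forall j, (j < rho)%N -> jet_coef g j = 0) ->
  (j < d * rho)%N -> (series_at_jet f g)`_j = 0.
Proof.
move=> /jet_poly_divXn [P [gP _]] jlt; rewrite series_at_jetE gP.
have [r ->] := mmap_order polyC P ('X^rho) msupp_truncated_series.
by rewrite -exprM mulnC coefXnM jlt.
Qed.

Lemma coef_series_initial rho (g : 'M[K]_(m.+1, n)) : (0 < rho)%N -> (d <= m)%N ->
  (forall j, (j < rho)%N -> jet_coef g j = 0) ->
  (series_at_jet f g)`_(d * rho) = eval_mpoly h (jet_coef g rho).
Proof.
move=> rho0 dm /jet_poly_divXn [P [gP P0]]; rewrite series_at_jetE gP.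
rewrite -[truncated_series m f](addrNK h) mmapD (mmap_dhomog _ _ _ h_homog).
have [r ->] := mmap_order polyC P ('X^rho)
  (fun al => @msupp_truncated_series_sub_initial al dm).
rewrite -!exprM ![(rho * _)%N]mulnC coefD !coefXnM ltnn subnn.
rewrite ltn_pmul2r // ltnSn add0r coef0_mmap_polyC.
by apply: meval_eq => i; rewrite P0.
Qed.

(* The terms of [f] of degree greater than [d] only move the coefficients of
   index at least [d rho + a], and the quadratic remainder of [h] those of index at
   least [(d - 2) rho + 2 a]; both are greater than [(d - 1) rho + a]. *)
Lemma coef_series_increment rho a (g g' : 'M[K]_(m.+1, n)) :
  (0 < rho)%N -> (rho < a)%N -> (0 < d <= m)%N ->
  (forall j, (j < rho)%N -> jet_coef g j = 0) ->
  (forall j, (j < a)%N -> jet_coef g j = jet_coef g' j) ->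
  (forall j, (j < d.-1 * rho + a)%N ->
     (series_at_jet f g)`_j = (series_at_jet f g')`_j) /\
  (series_at_jet f g')`_(d.-1 * rho + a) =
    (series_at_jet f g)`_(d.-1 * rho + a) +
    differential_form h (jet_coef g rho) (jet_coef g' a - jet_coef g a).
Proof.
move=> rho0 rhoa /andP[d0 dm] g0 gg'.
have [P [gP P0]] := jet_poly_divXn g0.
have [E [gE E0]] := jet_poly_increment gg'.
(* After factoring out [t ^ rho], the jets are [P] and its perturbation [P + t ^ s E], and the
   critical index [(d - 1) rho + a] becomes [d rho + s]. *)
set s := (a - rho)%N; have s0 : (0 < s)%N by rewrite subn_gt0.
have aE : a = (rho + s)%N by rewrite subnKC // ltnW.
have -> : (d.-1 * rho + a)%N = (d * rho + s)%N.
  by rewrite aE addnA -{2}(prednK d0) mulSn; lia.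
have g'P : jet_poly g' = fun i => 'X^rho * (P i + 'X^s * E i).
  by apply/funext => i; rewrite gE gP aE exprD; ring.
suff [Q [EQ Q0]] : exists Q, series_at_jet f g' =
    series_at_jet f g + 'X^(d * rho + s) * Q /\
    Q`_0 = differential_form h (jet_coef g rho) (jet_coef g' a - jet_coef g a).
  rewrite EQ; split=> [j jlt|]; first by rewrite coefD coefXnM jlt addr0.
  by rewrite coefD coefXnM ltnn subnn Q0.
have split_h x : mmap polyC x (truncated_series m f) =
    mmap polyC x (truncated_series m f - h) + mmap polyC x h.
  by rewrite -mmapD subrK.
rewrite !series_at_jetE gP g'P !split_h !(mmap_dhomog _ _ _ h_homog).
have [r1 ->] := mmap_increment_order polyC P E ('X^rho) ('X^s)
  (fun al => @msupp_truncated_series_sub_initial al dm).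
have [r2 ->] := mmap_taylor1 polyC P E ('X^s) h.
(* The first term is the differential of [h]; the others are the quadratic remainder of [h] and the
   change of the part of degree above [d]. Both vanish at [t = 0] because [s] and [rho] are
   positive. *)
exists (\sum_i E i * mmap polyC P h^`M(i) + 'X^s * r2 + 'X^rho * r1); split.
  rewrite -!exprM exprD !mulnS !exprD ![(rho * d)%N]mulnC muln0 expr0; ring.
rewrite !coefD !coefXnM rho0 s0 !addr0 coef_sum; apply: eq_bigr => i _.
rewrite coefM big_ord1 subn0 E0 coef0_mmap_polyC !mxE; congr (_ * _).
by apply: meval_eq => k; rewrite P0 !mxE.
Qed.

End SeriesAtJet.
End JetCoefficients.

(** * Truncations of a contact stratum *)

Lemma dvdXnP (K : fieldType) (k : nat) (p : {poly K}) :
  reflect (forall j, (j < k)%N -> p`_j = 0) ('X^k %| p).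
Proof.
apply: (iffP idP) => [/Pdiv.Field.dvdpP [q ->] j jk|p0]; first by rewrite coefMXn jk.
rewrite -(poly_take_drop k p); suff -> : take_poly k p = 0.
  by rewrite add0r dvdp_mull.
by apply/polyP => j; rewrite coef_take_poly coef0; case: ifP => // /p0.
Qed.

Lemma differential_formD (K : numClosedFieldType) (n : nat) (h : {mpoly K[n]})
    (x v w : 'rV[K]_n) :
  differential_form h x (v + w) = differential_form h x v + differential_form h x w.
Proof.
by rewrite -big_split; apply: eq_bigr => i _; rewrite !mxE mulrDl.
Qed.

Lemma differential_formB (K : numClosedFieldType) (n : nat) (h : {mpoly K[n]})
    (x v w : 'rV[K]_n) :
  differential_form h x (v - w) = differential_form h x v - differential_form h x w.
Proof.
by rewrite -sumrB; apply: eq_bigr => i _; rewrite !mxE mulrBl.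
Qed.

Lemma differential_formZ (K : numClosedFieldType) (n : nat) (h : {mpoly K[n]})
    (x v : 'rV[K]_n) (c : K) :
  differential_form h x (c *: v) = c * differential_form h x v.
Proof.
by rewrite mulr_sumr; apply: eq_bigr => i _; rewrite !mxE mulrA.
Qed.

Lemma differential_form_delta (K : numClosedFieldType) (n : nat)
    (h : {mpoly K[n]}) (x : 'rV[K]_n) (i : 'I_n) :
  differential_form h x (delta_mx 0 i) = eval_mpoly h^`M(i) x.
Proof.
rewrite /differential_form (bigD1 i) //= mxE !eqxx mul1r big1 ?addr0 // => j ji.
by rewrite mxE (negPf ji) andbF mul0r.
Qed.

(** For [rho <= a] the bound [d.-1 * rho + a] selects the equations that involve only coefficients
    of order at most [a], so the condition depends on the [a]-truncation of [g] although [g] is a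
    full jet. *)
Definition partial_solution {K : numClosedFieldType} {n m : nat}
    (f : power_series K n) (d rho a : nat) (g : 'M[K]_(m.+1, n)) :=
  [/\ forall j, (j < rho)%N -> jet_coef g j = 0, jet_coef g rho != 0 &
      forall j, (j <= d.-1 * rho + a)%N -> (series_at_jet f g)`_j = (j == m)%:R].

(** [m - d.-1 * rho] is the order of the coefficient whose equation has index [m], hence of the last
    constrained one. *)
Lemma stratum_range (d rho m : nat) :
  (1 < d)%N -> (0 < rho)%N -> (d * rho <= m)%N ->
  [/\ (rho <= m - d.-1 * rho)%N, (m - d.-1 * rho < m)%N &
      (d.-1 * rho + (m - d.-1 * rho))%N = m].
Proof.
case: d => [|[|d]] //= _ rho0 le; have : (0 < d.+1 * rho)%N by rewrite muln_gt0.
by move: le; rewrite mulSn; split; lia.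
Qed.

Section Stratum.
Context {K : numClosedFieldType} {n : nat}.
Context (d m : nat) (h : {mpoly K[n]}) (f F : power_series K n) (rho : nat).
Context (h_homog : h \is d.-homog).
Context (F0 : forall al, (mdeg al <= d)%N -> F al = 0).
Context (fE : forall al, f al = h@_al + F al).
Context (h_reg : forall x, x != 0 -> exists i, eval_mpoly h^`M(i) x != 0).
Context (d_gt1 : (1 < d)%N) (rho_gt0 : (0 < rho)%N) (drho_le : (d * rho <= m)%N).

Local Notation N := (m - d.-1 * rho)%N.
Local Notation FX := (contact_stratum f m (- rho%:Z)).
Local Notation solution := (partial_solution f d rho).

Let drhoE : (d * rho = d.-1 * rho + rho)%N.
Proof. by rewrite -{1}(prednK (ltnW d_gt1)) mulSn addnC. Qed.

Let d_le : (0 < d <= m)%N.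
Proof.
rewrite (ltnW d_gt1) /=; apply: leq_trans drho_le.
by rewrite -{1}[d]muln1 leq_mul2l rho_gt0 orbT.
Qed.

Let rho_le_N : (rho <= N)%N.
Proof. by have [] := stratum_range d_gt1 rho_gt0 drho_le. Qed.

Let N_le : (N < m)%N.
Proof. by have [] := stratum_range d_gt1 rho_gt0 drho_le. Qed.

Let Nsol : (d.-1 * rho + N)%N = m.
Proof. by have [] := stratum_range d_gt1 rho_gt0 drho_le. Qed.

Lemma contact_stratumP (g : 'M[K]_(m.+1, n)) : FX g <-> solution N g.
Proof.
have rho_le : (rho <= m)%N by rewrite (leq_trans rho_le_N) // ltnW // N_le.
split.
  move=> [[g0 /dvdXnP gm] [j [[gj glt] jE]]].
  have {}jE : val j = rho by move: jE; rewrite opprK => -[].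
  split=> [k krho||k].
  - have km : (k < m.+1)%N by rewrite ltnS (leq_trans (ltnW krho)).
    by rewrite (jet_coef_ord g (Ordinal km)) glt //= jE.
  - by rewrite -jE jet_coef_ord.
  rewrite Nsol -ltnS => /gm /eqP.
  by rewrite coefB coefXn subr_eq0 => /eqP.
move=> [g0 grho gm]; split; first split.
- by rewrite -jet_coef_ord g0.
- apply/dvdXnP => j jm; rewrite coefB coefXn gm ?subrr // Nsol //.
have rm : (rho < m.+1)%N by [].
exists (Ordinal rm); rewrite opprK; split=> //; split.
  by rewrite -jet_coef_ord.
by move=> k krho; rewrite -jet_coef_ord g0.
Qed.

Lemma partial_solution_eq a (g g' : 'M[K]_(m.+1, n)) : (rho <= a)%N ->
  (forall j, (j <= a)%N -> jet_coef g j = jet_coef g' j) ->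
  solution a g -> solution a g'.
Proof.
move=> ra E [g0 gr gm]; split.
- by move=> j jr; rewrite -E ?g0 // (leq_trans (ltnW jr)).
- by rewrite -E.
have [D _] := @coef_series_increment _ _ d m h f F h_homog F0 fE rho a.+1 g g'
  rho_gt0 ra d_le g0 E.
by move=> j jle; rewrite -D ?gm // addnS ltnS.
Qed.

(** The coefficients of index below [d rho] vanish automatically. The indicator on the right treats
    the cone ([d rho < m]) and the Milnor fibre ([d rho = m]) together. *)
Lemma partial_solution_initial (g : 'M[K]_(m.+1, n)) :
  solution rho g <-> [/\ forall j, (j < rho)%N -> jet_coef g j = 0,
     jet_coef g rho != 0 & eval_mpoly h (jet_coef g rho) = (d * rho == m)%N%:R].
Proof.
have [_ dm] := andP d_le.
split=> -[g0 gr gm]; split=> //.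
  by rewrite -(coef_series_initial h_homog F0 fE) // gm // drhoE.
move=> j; rewrite -drhoE leq_eqVlt => /predU1P [->|jlt].
  by rewrite (coef_series_initial h_homog F0 fE).
rewrite (coef_series_lt h_homog F0 fE g0) //.
by rewrite ltn_eqF // (leq_trans jlt).
Qed.

(** Exactly one equation is new, and by the increment formula it is affine in the next coefficient.
    The jet [g] is a base point for this affine equation: its own coefficient of order [a.+1] is
    arbitrary. *)
Lemma partial_solutionS a (g g' : 'M[K]_(m.+1, n)) : (rho <= a)%N ->
  (forall j, (j <= a)%N -> jet_coef g j = jet_coef g' j) ->
  solution a.+1 g' <-> solution a g /\
    differential_form h (jet_coef g rho) (jet_coef g' a.+1 - jet_coef g a.+1) =
      (d.-1 * rho + a.+1 == m)%N%:R - (series_at_jet f g)`_(d.-1 * rho + a.+1).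
Proof.
move=> ra E; have E' j : (j <= a)%N -> jet_coef g' j = jet_coef g j by move=> /E.
have incr (g0 : forall j, (j < rho)%N -> jet_coef g j = 0) :=
  @coef_series_increment _ _ d m h f F h_homog F0 fE rho a.+1 g g'
  rho_gt0 ra d_le g0 E.
split=> [sol'|[sol de]].
  have sol : solution a g.
    apply: (partial_solution_eq ra E'); case: sol' => g0 gr gm; split=> //.
    by move=> j jle; rewrite gm // (leq_trans jle) // addnS leqnSn.
  split=> //; have [g0 _ _] := sol; have [_ D] := incr g0.
  by have [_ _ <-] := sol'; rewrite // D addrAC subrr add0r.
have [g0' gr' gm'] := partial_solution_eq ra E sol; split=> // j.
rewrite leq_eqVlt => /predU1P [->|]; last by rewrite addnS ltnS; exact: gm'.
have [g0 _ _] := sol; have [_ ->] := incr g0.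
by rewrite de addrC subrK.
Qed.

(** Induction on the number of equations left. Each is solved by correcting a single coefficient
    along an axis on which the differential of [h] is nonzero. *)
Lemma partial_solution_lift a (g : 'M[K]_(m.+1, n)) : (rho <= a <= N)%N ->
  solution a g -> exists2 g', FX g' &
    forall j, (j <= a)%N -> jet_coef g j = jet_coef g' j.
Proof.
move=> /andP[ra aN]; elim: {a}(N - a)%N {-2}a (erefl (N - a)%N) ra aN g
    => [|k IH] a Ea ra aN g sol.
  exists g => //; apply/contact_stratumP.
  by have -> : N = a by apply/eqP; rewrite eqn_leq aN -subn_eq0 Ea eqxx.
have aN' : (a < N)%N by rewrite -subn_gt0 Ea.
have am : (a.+1 <= m)%N by rewrite (leq_trans aN') // ltnW // N_le.
have [_ /h_reg [i hi] _] := sol.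
(* [c] is the defect of [g] in the new equation, and [w] is the multiple of the [i]-th basis vector
   on which the differential takes the value [c]. *)
set c := (d.-1 * rho + a.+1 == m)%N%:R - (series_at_jet f g)`_(d.-1 * rho + a.+1).
set w := (c / eval_mpoly h^`M(i) (jet_coef g rho)) *: delta_mx 0 i : 'rV[K]_n.
pose g1 := g + \matrix_(j < m.+1, l < n) (if j == a.+1 :> nat then w 0 l else 0).
have g1E j : jet_coef g1 j = jet_coef g j + (if j == a.+1 then w else 0).
  rewrite jet_coefD; congr (_ + _); rewrite jet_coefE.
  case: ifPn => [jm|]; last by case: eqP => // ->; rewrite am.
  by apply/rowP => l; rewrite !mxE inordK //; case: eqP; rewrite ?mxE.
have E j : (j <= a)%N -> jet_coef g j = jet_coef g1 j.
  by move=> ja; rewrite g1E ltn_eqF ?addr0.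
have sol1 : solution a.+1 g1.
  apply/(partial_solutionS ra E); split=> //.
  rewrite g1E eqxx addrAC subrr add0r differential_formZ differential_form_delta.
  by rewrite divfK.
have [||||g' Fg' E'] := IH a.+1 _ _ _ g1 => //.
- by rewrite subnS Ea.
- exact: leq_trans ra (leqnSn a).
by exists g' => // j ja; rewrite E // E' // (leq_trans ja).
Qed.

(** Padding by zeros is a harmless choice, since the equations up to level [a] ignore the later
    coefficients; the converse is the lifting of partial solutions. *)
Lemma truncated_stratumP a (e : 'M[K]_(a.+1, n)) : (rho <= a <= N)%N ->
  (truncation a @` FX) e <-> solution a (jet_extension m e).
Proof.
move=> /andP[ra aN]; have am : (a <= m)%N by rewrite (leq_trans aN) // ltnW // N_le.
have extE (g : 'M[K]_(m.+1, n)) j : truncation a g = e -> (j <= a)%N ->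
    jet_coef g j = jet_coef (jet_extension m e) j.
  move=> <- ja; rewrite jet_coef_extension (leq_trans ja am).
  by rewrite jet_coef_truncation // ja.
split=> [[g /contact_stratumP [g0 gr gm] ge]|sol].
  apply: (@partial_solution_eq a g) => //; first by move=> j; exact: extE.
  split=> // j jle; apply: gm; apply: leq_trans jle _.
  by rewrite leq_add2l.
have [|g Fg E] := partial_solution_lift _ sol; first by rewrite ra.
exists g => //; apply: jet_coefP => j ja.
by rewrite jet_coef_truncation // ja -E // jet_coef_extension (leq_trans ja am).
Qed.

Lemma truncated_stratum_initialP (e : 'M[K]_(rho.+1, n)) :
  (truncation rho @` FX) e <-> [/\ forall j, (j < rho)%N -> jet_coef e j = 0,
     jet_coef e rho != 0 & eval_mpoly h (jet_coef e rho) = (d * rho == m)%N%:R].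
Proof.
have rm : (rho <= m)%N by rewrite (leq_trans rho_le_N) // ltnW // N_le.
have -> : (truncation rho @` FX) e <-> solution rho (jet_extension m e).
  by apply: truncated_stratumP; rewrite leqnn rho_le_N.
rewrite partial_solution_initial jet_coef_extension rm.
split=> -[e0 er eh]; split=> // j jr.
  by have := e0 _ jr; rewrite jet_coef_extension (leq_trans (ltnW jr)).
by rewrite jet_coef_extension e0 // if_same.
Qed.

(** In the extension by zero the coefficient of order [a.+1] vanishes, so this defect is the value
    that the differential of [h] must take on the actual coefficient. *)
Definition next_coef_rhs a (b : 'M[K]_(a.+1, n)) : K :=
  (d.-1 * rho + a.+1 == m)%N%:R -
  (series_at_jet f (jet_extension m b))`_(d.-1 * rho + a.+1).

Lemma truncated_stratumS a (e : 'M[K]_(a.+2, n)) : (rho <= a < N)%N ->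
  (truncation a.+1 @` FX) e <-> (truncation a @` FX) (truncation a e) /\
    differential_form h (jet_coef e rho) (jet_coef e a.+1) =
      next_coef_rhs (truncation a e).
Proof.
move=> /andP[ra aN].
have am : (a < m)%N by rewrite (leq_trans aN) // ltnW // N_le.
rewrite !truncated_stratumP ?ra ?aN ?(ltnW aN) ?(leq_trans ra (leqnSn a)) //.
have E j : (j <= a)%N -> jet_coef (jet_extension m (truncation a e)) j =
    jet_coef (jet_extension m e) j.
  move=> ja; rewrite !jet_coef_extension (leq_trans ja (ltnW am)).
  by rewrite jet_coef_truncation ?ja.
rewrite (partial_solutionS ra E) E // !jet_coef_extension am.
rewrite (leq_trans ra (ltnW am)) jet_coef_truncation // ltnn subr0 //.
Qed.

Lemma contact_stratum_truncation :
  FX = truncation N @^-1` (truncation N @` FX).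
Proof.
apply/seteqP; split=> [g Fg|g [g' /contact_stratumP Fg' gg']]; first by exists g.
apply/contact_stratumP; apply: (partial_solution_eq rho_le_N _ Fg') => j jN.
have := congr1 (fun e => jet_coef e j) gg'.
by rewrite !jet_coef_truncation ?jN // ltnW // N_le.
Qed.

End Stratum.

Lemma contact_stratum_set0 (K : numClosedFieldType) (n d m : nat)
    (h : {mpoly K[n]}) (f F : power_series K n) (p : int) :
  h \is d.-homog -> (forall al, (mdeg al <= d)%N -> F al = 0) ->
  (forall al, f al = h@_al + F al) ->
  (forall rho, p = - rho%:Z -> (0 < rho)%N -> (m < d * rho)%N) ->
  contact_stratum f m p = set0.
Proof.
move=> h_homog F0 fE prho; apply/seteqP; split=> // g [[g0 /dvdXnP gm] [j [[gj glt] jE]]].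
have pE : p = - (j%:Z) by rewrite jE opprK.
(* Order zero is excluded because the jets of the contact locus start at the origin. *)
have j0 : (0 < j)%N.
  rewrite lt0n; apply: contra gj => /eqP j0.
  by have -> : j = ord0 by [apply: val_inj]; rewrite g0.
have := gm m (ltnSn m); rewrite coefB (coef_series_lt h_homog F0 fE (rho := j)).
- by rewrite coefXn eqxx => /eqP; rewrite sub0r oppr_eq0 oner_eq0.
- move=> k kj; have km : (k < m.+1)%N by rewrite (ltn_trans kj).
  by rewrite (jet_coef_ord g (Ordinal km)) glt.
exact: prho.
Qed.

(** * Differentiability and small roots *)

Section Differentiability.
Context {K : numClosedFieldType} {V : normedModType K}.

Lemma differentiable_fsum (I : Type) (s : seq I) (W : normedModType K)
    (f : I -> V -> W) x :
  (forall i, differentiable (f i) x) ->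
  differentiable (fun y => \sum_(i <- s) f i y) x.
Proof.
move=> df; elim: s => [|i s IH].
  by rewrite (_ : (fun _ => _) = cst 0) //; apply/funext => y; rewrite big_nil.
rewrite (_ : (fun _ => _) = f i + (fun y => \sum_(i <- s) f i y)).
  exact: differentiableD.
by apply/funext => y; rewrite big_cons.
Qed.

Lemma differentiable_mx (p q : nat) (f : V -> 'M[K]_(p, q)) x :
  (forall i j, differentiable (fun y => f y i j : K) x) -> differentiable f x.
Proof.
move=> df; rewrite (_ : f = fun y => \sum_i \sum_j f y i j *: delta_mx i j).
  apply: (@differentiable_fsum _ _ _
    (fun i y => \sum_j f y i j *: delta_mx i j)) => i.
  apply: (@differentiable_fsum _ _ _ (fun j y => f y i j *: delta_mx i j)) => j.
  exact: differentiableZl.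
by apply/funext => y; exact: matrix_sum_delta.
Qed.

Lemma differentiable_mxE (p q : nat) (f : V -> 'M[K]_(p, q)) x i j :
  differentiable f x -> differentiable (fun y => f y i j : K) x.
Proof.
move=> df; exact: (differentiable_comp df (differentiable_coord (f x) i j)).
Qed.

(** All coefficients are treated at once, as a coefficient of a product involves all the lower ones
    of its factors. This makes the right-hand sides of the equations holomorphic in the jet. *)
Lemma differentiable_coef_mmap (n : nat) (P : V -> 'I_n -> {poly K})
    (p : {mpoly K[n]}) x j :
  (forall i j, differentiable (fun y => (P y i)`_j : K) x) ->
  differentiable (fun y => (mmap polyC (P y) p)`_j : K) x.
Proof.
move=> dP; elim/mpoly_ring_ind: p j => [c|i|p q dp dq|p q dp dq] j.
- rewrite (_ : (fun _ => _) = cst (c%:P)`_j) //.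
  by apply/funext => y; rewrite mmapC.
- rewrite (_ : (fun _ => _) = (fun y => (P y i)`_j)) //.
  by apply/funext => y; rewrite mmapX mmap1U.
- rewrite (_ : (fun _ => _) = (fun y => (mmap polyC (P y) p)`_j : K) +
      (fun y => (mmap polyC (P y) q)`_j : K)); first exact: differentiableD.
  by apply/funext => y; rewrite mmapD coefD.
rewrite (_ : (fun _ => _) = fun y => \sum_(k < j.+1)
    ((mmap polyC (P y) p)`_k * (mmap polyC (P y) q)`_(j - k))); last first.
  by apply/funext => y; rewrite rmorphM coefM.
apply: (@differentiable_fsum _ _ K (fun k : 'I_j.+1 =>
  ((fun y => (mmap polyC (P y) p)`_k) * (fun y => (mmap polyC (P y) q)`_(j - k))))).
by move=> k; apply: differentiableM.
Qed.

Lemma differentiable_eval_mpoly (n : nat) (p : {mpoly K[n]}) (f : V -> 'rV[K]_n) x :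
  differentiable f x -> differentiable (fun y => eval_mpoly p (f y) : K) x.
Proof.
move=> df; rewrite (_ : (fun _ => _) =
    fun y => (mmap polyC (fun i => (f y 0 i)%:P) p)`_0).
  apply: differentiable_coef_mmap => i j.
  under eq_fun do rewrite coefC; case: (j == 0); last exact: differentiable_cst.
  exact: differentiable_mxE.
apply/funext => y; rewrite coef0_mmap_polyC; apply: meval_eq => i.
by rewrite coefC.
Qed.

End Differentiability.

Section DividedDifferences.
Context {K : numClosedFieldType} {n : nat}.

Lemma continuous_eval_mpoly (h : {mpoly K[n]}) : continuous (eval_mpoly h).
Proof.
move=> x; apply: differentiable_continuous.
by apply: differentiable_eval_mpoly.
Qed.

Lemma eval_mpolyM (p q : {mpoly K[n]}) x :
  eval_mpoly (p * q) x = eval_mpoly p x * eval_mpoly q x.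
Proof. exact: mevalM. Qed.

Lemma eval_mpolyD (p q : {mpoly K[n]}) x :
  eval_mpoly (p + q) x = eval_mpoly p x + eval_mpoly q x.
Proof. exact: mevalD. Qed.

(** Divided differences: an exact, continuous substitute for the mean value theorem, whose diagonal
    values are the partial derivatives. *)
Lemma eval_mpoly_increment (h : {mpoly K[n]}) :
  exists Q : 'I_n -> 'rV[K]_n * 'rV[K]_n -> K,
    [/\ forall i, continuous (Q i),
        forall x y, eval_mpoly h y - eval_mpoly h x =
          \sum_i (y 0 i - x 0 i) * Q i (x, y) &
        forall i x, Q i (x, x) = eval_mpoly h^`M(i) x].
Proof.
elim/mpoly_ring_ind: h => [c|i|p q [P [Pc PE Pd]] [Q [Qc QE Qd]]
  |p q [P [Pc PE Pd]] [Q [Qc QE Qd]]].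
- exists (fun _ => cst 0); split=> [i|x y|i x]; first exact: cst_continuous.
    by rewrite /eval_mpoly !mevalC subrr big1 // => i _; rewrite mulr0.
  by rewrite mderivC /eval_mpoly meval0.
- exists (fun j => cst (j == i)%:R); split=> [j|x y|j x].
  + exact: cst_continuous.
  + rewrite /eval_mpoly !mevalXU (bigD1 i) //= eqxx mulr1 big1 ?addr0 //.
    by move=> j /negPf ->; rewrite mulr0.
  + rewrite /eval_mpoly mderivX mnm1E eq_sym; case: eqP => [->|_] /=.
      by rewrite scale1r -{1}[U_(j)%MM]add0m addmK mpolyX0 meval1.
    by rewrite scale0r meval0.
- exists (fun i => (P i + Q i)); split=> [i x|x y|i x].
  + by apply: continuousD; [exact: Pc|exact: Qc].
  + rewrite !eval_mpolyD opprD addrACA PE QE -big_split; apply: eq_bigr => i _.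
    by rewrite mulrDr.
  + by rewrite mderivD eval_mpolyD -Pd -Qd.
(* Discrete Leibniz rule: [p(y) q(y) - p(x) q(x)] is [p(y) (q(y) - q(x)) + q(x) (p(y) - p(x))]. *)
exists (fun i => (eval_mpoly p \o snd) * Q i + (eval_mpoly q \o fst) * P i).
split=> [i x|x y|i x].
- apply: continuousD; (apply: continuousM; last by [exact: Pc|exact: Qc]).
    by apply: continuous_comp; [exact: cvg_snd|exact: continuous_eval_mpoly].
  by apply: continuous_comp; [exact: cvg_fst|exact: continuous_eval_mpoly].
- rewrite !eval_mpolyM.
  transitivity (eval_mpoly p y * (eval_mpoly q y - eval_mpoly q x) +
     eval_mpoly q x * (eval_mpoly p y - eval_mpoly p x)); first by ring.
  rewrite PE QE !mulr_sumr -big_split; apply: eq_bigr => i _ /=.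
  by rewrite !fctE /=; ring.
- rewrite mderivM eval_mpolyD !eval_mpolyM -Pd -Qd !fctE /=; ring.
Qed.

End DividedDifferences.

(** A bound on the logarithmic derivative at [0], multiplied out so that the linear factors can be
    peeled off one at a time. *)
Lemma norm_coef1_prod_roots (K : numFieldType) (delta : K) (rs : seq K) :
  0 < delta -> (forall r, r \in rs -> delta <= `|r|) ->
  let q := \prod_(r <- rs) ('X - r%:P) in
  delta * `|q`_1| <= (size rs)%:R * `|q`_0|.
Proof.
move=> d0; elim: rs => [|r rs IH] rsd /=.
  by rewrite big_nil !coef1 normr0 mulr0 mul0r.
rewrite big_cons; set q := \prod_(r <- rs) _ in IH *.
have dr : delta <= `|r| by rewrite rsd ?mem_head.
have {}IH : delta * `|q`_1| <= (size rs)%:R * `|q`_0|.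
  by apply: IH => s srs; rewrite rsd // in_cons srs orbT.
rewrite !mulrBl !coefB !coefXM !coefCM /= sub0r normrN normrM.
rewrite -natr1 mulrDl mul1r [leRHS]addrC.
apply: le_trans (_ : delta * (`|q`_0| + `|r| * `|q`_1|) <= _).
  by rewrite ler_pM2l // -normrM ler_normB.
rewrite mulrDr lerD // ?ler_wpM2r //.
by rewrite mulrCA [leRHS]mulrCA ler_wpM2l.
Qed.

(* If all the roots [r] had norm at least [delta], then
   [p'(0) / p(0) = - \sum 1 / r] would have norm at most [k / delta]. *)
Lemma small_root (K : numClosedFieldType) (k : nat) (p : {poly K}) (delta : K) :
  0 < delta -> (size p <= k)%N -> k%:R * `|p`_0| < delta * `|p`_1| ->
  exists2 r, root p r & `|r| < delta.
Proof.
move=> d0 pk; have [rs pE] := closed_field_poly_normal p.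
have [/hasP [r rrs rd] _|/hasPn big] := boolP (has (fun r => `|r| < delta) rs).
  by exists r => //; rewrite pE /root hornerZ -/(root _ _) mulf_eq0 -/(root _ _)
    root_prod_XsubC rrs orbT.
have [->|p0] := eqVneq p 0; first by rewrite !coef0 normr0 !mulr0 ltxx.
have rsk : (size rs <= k)%N.
  apply: leq_trans pk; rewrite pE size_scale ?lead_coef_eq0 //.
  by rewrite size_prod_XsubC leqnSn.
have H : delta * `|(\prod_(r <- rs) ('X - r%:P))`_1| <=
    (size rs)%:R * `|(\prod_(r <- rs) ('X - r%:P))`_0|.
  apply: norm_coef1_prod_roots => // r rrs.
  by rewrite (real_leNgt (gtr0_real d0) (normr_real _)) big.
rewrite pE !coefZ !normrM => lt; suff : delta * (`|lead_coef p| *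
    `|(\prod_(r <- rs) ('X - r%:P))`_1|) <=
    k%:R * (`|lead_coef p| * `|(\prod_(r <- rs) ('X - r%:P))`_0|).
  by move=> le; have := lt_le_trans lt le; rewrite ltxx.
rewrite mulrCA [leRHS]mulrCA ler_wpM2l // (le_trans H) // ler_wpM2r // ler_nat //.
Qed.

(** The factor [k] in [small_root] must not depend on the parameter of the family of polynomials;
    this uniform bound on the sizes supplies it. *)
Lemma size_mmap_polyC_bound (K : idomainType) (n k : nat) (p : {mpoly K[n]}) :
  exists N, forall x : 'I_n -> {poly K}, (forall i, (size (x i) <= k)%N) ->
    (size (mmap polyC x p) <= N)%N.
Proof.
elim/mpoly_ring_ind: p => [c|i|p q [N pN] [M qM]|p q [N pN] [M qM]].
- by exists 1%N => x _; rewrite mmapC size_polyC_leq1.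
- by exists k => x xk; rewrite mmapX mmap1U.
- exists (maxn N M) => x xk; rewrite mmapD (leq_trans (size_polyD _ _)) //.
  by rewrite geq_max !leq_max pN // qM // orbT.
exists (N + M)%N => x xk; rewrite rmorphM (leq_trans (size_polyMleq _ _)) //.
by rewrite (leq_trans (leq_pred _)) // leq_add // ?pN ?qM.
Qed.

(** * The implicit function *)

Lemma is_derive_cvg (K : numFieldType) (V W : normedModType K) (f : V -> W)
    (a v : V) (l : W) :
  (t^-1 *: (f (t *: v + a) - f a)) @[t --> (0 : K)^'] --> l ->
  is_derive a v f l.
Proof.
move=> fl; apply: DeriveDef; first by apply/cvg_ex; exists l.
exact: (@cvg_lim W).
Qed.

Lemma near_norm_lt (K : numFieldType) (T : Type) (F : set_system T)
    {FF : Filter F} (f : T -> K) (e : K) :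
  f y @[y --> F] --> (0 : K) -> 0 < e -> \forall y \near F, `|f y| < e.
Proof.
move=> /cvgrPdist_lt fc e0; apply: filterS (fc _ e0) => y.
by rewrite sub0r normrN.
Qed.

Lemma near_neq0 (K : numFieldType) (T : Type) (F : set_system T)
    {FF : Filter F} (f : T -> K) (l : K) :
  f y @[y --> F] --> l -> l != 0 -> \forall y \near F, f y != 0.
Proof.
move=> /cvgrPdist_lt fc; rewrite -normr_gt0 => l0; apply: filterS (fc _ l0) => y.
by apply: contraTneq => ->; rewrite subr0 ltxx.
Qed.

Lemma cvg_to_pair (T : Type) (F : set_system T) {FF : Filter F}
    (U V : topologicalType) (f : T -> U) (g : T -> V) (a : U) (b : V) :
  f x @[x --> F] --> a -> g x @[x --> F] --> b -> (f x, g x) @[x --> F] --> (a, b).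
Proof. exact: cvg_pair. Qed.

Section ImplicitCurve.
Context {K : numFieldType}.

(* The hypothesis on the roots of [p z] only provides some solution; that
   [w' - w = - (A / B) (z' - z)] for any two solutions, with [A / B] small, gives
   uniqueness, continuity and differentiability. *)
Lemma implicit_root (G : K * K -> K) (A B : (K * K) * (K * K) -> K) (k : nat)
    (p : K -> {poly K}) :
  continuous A -> continuous B ->
  (forall q r, G r - G q = (r.1 - q.1) * A (q, r) + (r.2 - q.2) * B (q, r)) ->
  G (0, 0) = 0 -> A ((0, 0), (0, 0)) = 0 -> B ((0, 0), (0, 0)) != 0 ->
  (forall z w, (p z).[w] = G (z, w)) ->
  (forall z, (p z)`_1 = B ((z, 0), (z, 0))) ->
  (forall z delta, 0 < delta -> k%:R * `|(p z)`_0| < delta * `|(p z)`_1| ->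
     exists2 r, root (p z) r & `|r| < delta) ->
  exists w : K^o -> K^o, [/\ w 0 = 0,
    \forall z \near (0 : K^o), differentiable w z /\ G (z, w z) = 0 &
    is_derive (0 : K^o) 1 w 0].
Proof.
move=> Ac Bc GAB G0 A0 B0 pG p1 p_root.
have : \forall q \near ((0, 0), (0, 0)), B q != 0 /\ `|A q / B q| < 1.
  apply: filterI; first exact: (near_neq0 (Bc _) B0).
  have ABc : A q / B q @[q --> (((0, 0), (0, 0)) : (K * K) * (K * K))] -->
      A ((0, 0), (0, 0)) / B ((0, 0), (0, 0)).
    by apply: cvgM; [exact: Ac|exact: (cvgV B0 (Bc _))].
  by rewrite A0 mul0r in ABc; exact: (near_norm_lt ABc ltr01).
move=> /nbhs_ballP [delta /= d0 box].
have {}box z w z' w' : `|z| < delta -> `|w| < delta -> `|z'| < delta ->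
    `|w'| < delta -> let q := ((z, w), (z', w')) in B q != 0 /\ `|A q / B q| < 1.
  by move=> zd wd zd' wd'; apply: box; split; split; rewrite -ball_normE /= sub0r normrN.
pose sol z w := `|w| < delta /\ G (z, w) = 0.
(* The default value [0] is taken only where no solution of norm below [delta] exists, which does
   not happen near [0]. *)
pose w : K -> K := fun z => xget 0 [set w | sol z w].
have incr z z' y y' : `|z| < delta -> `|z'| < delta -> sol z y -> sol z' y' ->
    y' - y = - (A ((z, y), (z', y')) / B ((z, y), (z', y'))) * (z' - z).
  move=> zd zd' [yd Gy] [yd' Gy']; have [Bn _] := box _ _ _ _ zd yd zd' yd'.
  have := GAB (z, y) (z', y'); rewrite Gy Gy' subr0 /= => /eqP.
  rewrite eq_sym addrC addr_eq0 => /eqP E.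
  by apply: (mulIf Bn); rewrite E; field.
(* From [|A / B| < 1]. Taking [z = z'] gives uniqueness, in particular [w 0 = 0]; letting [z'] tend
   to [z] gives continuity. *)
have lip z z' y y' : `|z| < delta -> `|z'| < delta -> sol z y -> sol z' y' ->
    `|y' - y| <= `|z' - z|.
  move=> zd zd' sy sy'; rewrite (incr z z' y y') // normrM normrN.
  have [[yd _] [yd' _]] := (sy, sy').
  by rewrite ler_piMl // ltW //; have [] := box _ _ _ _ zd yd zd' yd'.
(* At [0] the polynomial [p z] has value [z A] and first coefficient [B]. The former tends to [0]
   and the latter to a nonzero limit, so the hypothesis on roots applies for small [z]. *)
have w_sol : \forall z \near nbhs (0 : K), `|z| < delta /\ sol z (w z).
  have cvg_id0 : z @[z --> nbhs (0 : K)] --> (0 : K) by exact: cvg_id.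
  have cvg_00 : (0 : K) @[z --> nbhs (0 : K)] --> (0 : K) by exact: cvg_cst.
  have cvg_p0 : (p z)`_0 @[z --> nbhs (0 : K)] --> (0 : K).
    rewrite (_ : (fun z => _) = fun z => z * A ((0, 0), (z, 0))); last first.
      apply/funext => z; rewrite -horner_coef0 pG.
      by have := GAB (0, 0) (z, 0); rewrite G0 /= !subr0 mul0r addr0 => ->.
    rewrite -[X in _ --> X](mul0r (A ((0, 0), (0, 0)))).
    apply: cvgM => //; apply: continuous_cvg; first exact: Ac.
    by do 2![apply: cvg_to_pair => //].
  have cvg_p1 : (p z)`_1 @[z --> nbhs (0 : K)] --> B ((0, 0), (0, 0)).
    under eq_fun do rewrite p1.
    apply: continuous_cvg; first exact: Bc.
    by do 2![apply: cvg_to_pair => //].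
  have n1 : \forall z \near nbhs (0 : K), (p z)`_1 != 0.
    exact: near_neq0 cvg_p1 B0.
  have n2 : \forall z \near nbhs (0 : K), `|k%:R * (p z)`_0 / (p z)`_1| < delta.
    apply: near_norm_lt => //.
    rewrite -[X in _ --> X](mul0r (B ((0, 0), (0, 0)))^-1) -[X in X * _^-1](mulr0 k%:R).
    by apply: cvgM; [apply: cvgM => //; exact: cvg_cst|exact: (cvgV B0)].
  have n3 : \forall z \near nbhs (0 : K), `|z| < delta by apply: near_norm_lt.
  near=> z; split; first by near: z.
  apply: (@xgetPex _ 0 [set y | sol z y]).
  have p1n : (p z)`_1 != 0 by near: z.
  have [|y /rootP y0 yd] := p_root z delta d0.
    rewrite -ltr_pdivrMr ?normr_gt0 // -normfV -[k%:R]normr_nat -!normrM.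
    by near: z.
  by exists y; split=> //; rewrite -pG.
have [_ w0s] := nbhs_singleton w_sol.
have w0 : w 0 = 0.
  have sol0 : sol 0 0 by split; rewrite ?normr0.
  have := lip 0 0 0 (w 0); rewrite !subr0 normr0 => /(_ d0 d0 sol0 w0s).
  by rewrite normr_le0 => /eqP.
have w_diff : \forall z \near (0 : K), is_derive (z : K^o) 1 (w : K^o -> K^o)
    (- (A ((z, w z), (z, w z)) / B ((z, w z), (z, w z)))).
  (* Differentiating at [z] requires [w] to be a solution on a whole neighbourhood of [z], not only
     at [z]. *)
  move: (near_join w_sol); apply: filterS2 w_sol => z [zd wz] near_z.
  have wc : w y @[y --> nbhs z] --> w z.
    apply/cvgrPdist_lt => e e0.
    have zt : \forall t \near nbhs z, `|z - t| < e.
      apply: (near_norm_lt _ e0); rewrite -[X in _ --> X](subrr z).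
      by apply: cvgB; [exact: cvg_cst|exact: cvg_id].
    move: zt near_z; apply: filterS2 => t zt [td wt]; apply: le_lt_trans zt.
    by rewrite distrC [leRHS]distrC; apply: lip.
  apply: is_derive_cvg.
  have shz : t%:A + z @[t --> (0 : K)^'] --> z.
    rewrite -[X in _ --> X](add0r (z : K)); apply: cvgD; last exact: cvg_cst.
    rewrite -[X in _ --> X](scale0r (1 : K^o)); apply: cvgZr_tmp; exact: nbhs_dnbhs.
  have cvg_q : ((z, w z), (t%:A + z, w (t%:A + z))) @[t --> (0 : K)^'] -->
      (((z, w z), (z, w z)) : (K * K) * (K * K)).
    apply: cvg_to_pair; first exact: cvg_cst.
    by apply: cvg_to_pair => //; apply: continuous_cvg.
  have Bn : B ((z, w z), (z, w z)) != 0 by have [wd _] := wz; have [] := box z (w z) z (w z).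
  have quot : \forall t \near (0 : K)^', - (A ((z, w z), (t%:A + z, w (t%:A + z))) /
      B ((z, w z), (t%:A + z, w (t%:A + z)))) = t^-1 *: (w (t%:A + z) - w z).
    have tn0 : \forall t \near (0 : K)^', t != 0 by exact: nbhs_dnbhs_neq.
    have near_tz : \forall t \near (0 : K)^',
      `|t%:A + z| < delta /\ sol (t%:A + z) (w (t%:A + z)) by exact: (shz _ near_z).
    near=> t; have [td wt] : `|t%:A + z| < delta /\ sol (t%:A + z) (w (t%:A + z)).
      by near: t.
    have t0 : t != 0 by near: t.
    rewrite (incr z (t%:A + z)) //.
    by rewrite addrK /GRing.scale /= mulr1 mulrCA mulVf // mulr1.
  apply: cvg_trans (near_eq_cvg quot) _.
  apply: cvgN; apply: cvgM; first exact: (continuous_cvg _ (Ac _) cvg_q).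
  exact: (cvgV Bn (continuous_cvg _ (Bc _) cvg_q)).
exists w; split=> //.
  by apply: filterS2 w_sol w_diff => z [_ [_ Gz]] wz; split=> //; apply/derivable1_diffP.
have := nbhs_singleton w_diff; rewrite w0 A0 mul0r oppr0 //.
Unshelve. all: by end_near.
Qed.

End ImplicitCurve.

(** * Tangent spaces *)

Lemma is_derive_cvg_to (K : numFieldType) (V W : normedModType K) (f : V -> W)
    (a v : V) (l : W) :
  is_derive a v f l -> (t^-1 *: (f (t *: v + a) - f a)) @[t --> (0 : K)^'] --> l.
Proof. by move=> [fd <-]; exact: fd. Qed.

Lemma cvg_bigsum (K : numFieldType) (V : normedModType K) (T : Type)
    (F : set_system T) {FF : Filter F} (I : Type) (s : seq I) (f : I -> T -> V)
    (a : I -> V) :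
  (forall i, f i t @[t --> F] --> a i) ->
  (\sum_(i <- s) f i t) @[t --> F] --> \sum_(i <- s) a i.
Proof.
move=> fa; elim: s => [|i s IH].
  by rewrite big_nil; under eq_fun do rewrite big_nil; exact: cvg_cst.
by rewrite big_cons; under eq_fun do rewrite big_cons; exact: cvgD.
Qed.

Lemma cvg_near_congr (T : Type) (U : topologicalType) (F : set_system T)
    {FF : Filter F} (f g : T -> U) (l : U) :
  f t @[t --> F] --> l -> (\forall t \near F, f t = g t) -> g t @[t --> F] --> l.
Proof. by move=> fl fg; exact: cvg_trans (near_eq_cvg fg) fl. Qed.

Lemma cvg_near_eq (K : numFieldType) (T : Type) (F : set_system T)
    {FF : ProperFilter F} (f : T -> K) (a b : K) :
  f t @[t --> F] --> a -> (\forall t \near F, f t = b) -> a = b.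
Proof.
move=> fa fb; apply: (cvg_unique (@norm_hausdorff K K^o) fa).
exact: cvg_near_cst.
Qed.

Lemma cvg_dnbhs_scale (K : numFieldType) (V : normedModType K) (v x : V) :
  t *: v + x @[t --> (0 : K)^'] --> x.
Proof.
rewrite -[X in _ --> X]add0r; apply: cvgD; last exact: cvg_cst.
rewrite -[X in _ --> X](scale0r v); apply: cvgZr_tmp; exact: nbhs_dnbhs.
Qed.

Lemma differentiable_jet_coef (K : numClosedFieldType) (V : normedModType K)
    (n m : nat) (g : V -> 'M[K]_(m.+1, n)) (j : nat) x :
  differentiable g x -> differentiable (fun y => jet_coef (g y) j) x.
Proof.
move=> dg; apply: differentiable_mx => i l; rewrite ord1.
under eq_fun do rewrite jet_coefE; case: (j <= m)%N.
  by under eq_fun do rewrite mxE; exact: differentiable_mxE.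
by under eq_fun do rewrite mxE; exact: differentiable_cst.
Qed.

Lemma horner_mmap_polyC (n : nat) (K : comNzRingType) (x : 'I_n -> {poly K})
    (p : {mpoly K[n]}) (c : K) :
  (mmap polyC x p).[c] = p.@[fun i => (x i).[c]].
Proof.
rewrite -[_.[c]]/(horner_eval c _) rmorph_mmap /meval.
by rewrite /mmap; apply: eq_bigr => al _; rewrite /= /horner_eval hornerC.
Qed.

Section TangentSpace.
Context {K : numClosedFieldType} {n : nat}.
Implicit Types (h : {mpoly K[n]}) (x v : 'rV[K]_n).

Lemma coef1_mmap_polyC h (x e : 'I_n -> K) :
  (mmap polyC (fun j => (x j)%:P + 'X * (e j)%:P) h)`_1 =
  \sum_j e j * h^`M(j).@[x].
Proof.
have [r ->] := mmap_taylor1 polyC (fun j => (x j)%:P) (fun j => (e j)%:P) 'X h.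
have -> : mmap polyC (fun j => (x j)%:P) h = (h.@[x])%:P.
  by rewrite /meval rmorph_mmap.
rewrite !coefD coefC coefXM coefXnM /= add0r addr0 coef_sum; apply: eq_bigr => j _.
rewrite coefCM coef0_mmap_polyC; congr (_ * _).
by apply: meval_eq => i; rewrite coefC.
Qed.

(** Moving along [v] changes [h] only to second order, so the correction [w] along the [i]-th axis
    has derivative [0] at [0] and the corrected curve keeps the velocity [v]. *)
Lemma implicit_curve h x v (i : 'I_n) :
  differential_form h x v = 0 -> eval_mpoly h^`M(i) x != 0 ->
  exists w : K^o -> K^o, [/\ w 0 = 0,
    \forall z \near (0 : K^o), differentiable w z /\
      eval_mpoly h (x + z *: v + w z *: delta_mx 0 i) = eval_mpoly h x &
    is_derive (0 : K^o) 1 w 0].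
Proof.
move=> xv hi; have [Q [Qc QE Qd]] := eval_mpoly_increment h.
pose e : 'rV[K]_n := delta_mx 0 i.
pose Y (p : K * K) : 'rV[K]_n := x + p.1 *: v + p.2 *: e.
have Y0 : Y (0, 0) = x by rewrite /Y !scale0r !addr0.
have Yc : continuous Y.
  move=> p; apply: cvgD; first apply: cvgD; first exact: cvg_cst.
    by apply: cvgZr_tmp; exact: cvg_fst.
  by apply: cvgZr_tmp; exact: cvg_snd.
have YYc (q : (K * K) * (K * K)) : (Y q'.1, Y q'.2) @[q' --> q] --> (Y q.1, Y q.2).
  apply: cvg_to_pair; (apply: continuous_cvg; first exact: Yc).
    exact: cvg_fst.
  exact: cvg_snd.
(* Divided differences of [h] in the directions [v] and [e]. At the base point they are the
   differential at [v], which is zero, and the [i]-th partial derivative, which is not. *)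
pose A (q : (K * K) * (K * K)) := \sum_j v 0 j * Q j (Y q.1, Y q.2).
pose B (q : (K * K) * (K * K)) := Q i (Y q.1, Y q.2).
pose G (p : K * K) := eval_mpoly h (Y p) - eval_mpoly h x.
pose P (z : K) := mmap polyC
  (fun j => ((x + z *: v) 0 j)%:P + 'X * (e 0 j)%:P) h - (eval_mpoly h x)%:P.
(* The coordinates are affine in the unknown, hence the size [2]; [maxn N 1] below makes room for
   the constant subtracted in [P]. *)
have [N PN] := size_mmap_polyC_bound 2 h.
have [||||||||z delta d0|w [w0 ws wd]] := @implicit_root K G A B (maxn N 1) P.
- move=> q; apply: (@cvg_bigsum _ K) => j; apply: cvgM; first exact: cvg_cst.
  exact: (continuous_cvg _ (Qc j _) (YYc q)).
- by move=> q; exact: (continuous_cvg _ (Qc i _) (YYc q)).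
- move=> q r; rewrite /G opprB addrA subrK QE mulr_sumr.
  have -> : (r.2 - q.2) * B (q, r) = \sum_j (r.2 - q.2) * e 0 j * Q j (Y q, Y r).
    rewrite (bigD1 i) //= mxE !eqxx mulr1 big1 ?addr0 // => j /negPf ji.
    by rewrite mxE ji andbF mulr0 mul0r.
  rewrite -big_split; apply: eq_bigr => j _ /=.
  by rewrite !mxE; ring.
- by rewrite /G Y0 subrr.
- rewrite /A Y0 -[RHS]xv; apply: eq_bigr => j _; by rewrite Qd.
- by rewrite /B Y0 Qd.
- move=> z w; rewrite /P hornerD hornerN hornerC horner_mmap_polyC /G; congr (_ - _).
  by apply: meval_eq => j; rewrite hornerD hornerC hornerM hornerX hornerC !mxE.
- move=> z; rewrite /P coefB coefC subr0 coef1_mmap_polyC /B Qd.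
  rewrite (bigD1 i) //= mxE !eqxx mul1r big1 ?addr0 => [|j /negPf ji].
    by apply: meval_eq => j; rewrite /Y !mxE mul0r addr0.
  by rewrite mxE ji andbF mul0r.
- apply: small_root => //; rewrite (leq_trans (size_polyD _ _)) // size_polyN.
  rewrite geq_max !leq_max size_polyC_leq1 orbT andbT PN // => j.
  rewrite (leq_trans (size_polyD _ _)) // geq_max.
  rewrite (leq_trans (size_polyC_leq1 _)) //= (leq_trans (size_polyMleq _ _)) //.
  by rewrite size_polyX; have := size_polyC_leq1 (e 0 j); lia.
exists w; split=> //; apply: filterS ws => z [dz /eqP].
by rewrite subr_eq0 => /eqP.
Qed.

Definition top_jet rho (x : 'rV[K]_n) : 'M[K]_(rho.+1, n) :=
  \matrix_(j < rho.+1, l < n) (if j == ord_max then x 0 l else 0).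

Lemma jet_coef_top_jet rho x j :
  jet_coef (top_jet rho x) j = if j == rho then x else 0.
Proof.
rewrite jet_coefE; case: ifPn => [jr|].
  apply/rowP => l; rewrite !mxE -val_eqE /= inordK //.
  by case: eqP; rewrite ?mxE.
by case: eqP => // ->; rewrite leqnn.
Qed.

Lemma jet_coefZ m (g : 'M[K]_(m.+1, n)) (c : K) j :
  jet_coef (c *: g) j = c *: jet_coef g j.
Proof.
by rewrite !jet_coefE; case: ifP => _; rewrite ?scaler0 //; apply/rowP => i; rewrite !mxE.
Qed.

(** The level [c] is free so as to cover the cone and the Milnor fibre. For a velocity, the
    vanishing difference quotients of [h] along the curve converge to the differential at [v],
    through divided differences; the converse uses the implicit curve, placed in the top
    coefficient. *)
Lemma tangent_space_jets h rho (c : K) (X : set 'M[K]_(rho.+1, n))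
    (e v : 'M[K]_(rho.+1, n)) (i : 'I_n) :
  (forall g, X g <-> [/\ forall j, (j < rho)%N -> jet_coef g j = 0,
     jet_coef g rho != 0 & eval_mpoly h (jet_coef g rho) = c]) ->
  X e -> eval_mpoly h^`M(i) (jet_coef e rho) != 0 ->
  tangent_space X e v <-> (forall j, (j < rho)%N -> jet_coef v j = 0) /\
    differential_form h (jet_coef e rho) (jet_coef v rho) = 0.
Proof.
move=> XP Xe hi; split=> [[y [yX y0 yd]]|[v0 hv]].
  have /XP [e0 er eh] := Xe; have [yd0 _] := nbhs_singleton yX.
  have sh := @cvg_dnbhs_scale K K^o 1 0.
  have yX' : \forall t \near (0 : K)^', X (y (t%:A + 0)).
    by apply: (sh (fun z => X (y z))); move: yX; apply: filterS => z [].
  have yqE j l : (t^-1 * (jet_coef (y (t%:A + 0)) j 0 l - jet_coef e j 0 l))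
      @[t --> (0 : K)^'] --> jet_coef v j 0 l.
    have coef_c : continuous (fun M : 'M[K]_(rho.+1, n) => jet_coef M j 0 l : K).
      move=> M; apply: differentiable_continuous; apply: differentiable_mxE.
      exact: differentiable_jet_coef.
    have lim := continuous_cvg (dnbhs_filter _) (coef_c _) (is_derive_cvg_to yd).
    apply: (cvg_near_congr lim); apply: nearW => t /=.
    rewrite jet_coefZ [_ - _]addrC -scaleN1r jet_coefD jet_coefZ y0 !mxE.
    by rewrite mulN1r addrC.
  split=> [j jr|].
    apply/rowP => l; rewrite [RHS]mxE; apply: (cvg_near_eq (yqE j l)).
    move: yX'; apply: filterS => t /XP [yt0 _ _].
    by rewrite yt0 // e0 // mxE subrr mulr0.
  have [Q [Qc QE Qd]] := eval_mpoly_increment h.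
  have Qlim l : Q l (jet_coef e rho, jet_coef (y (t%:A + 0)) rho)
      @[t --> (0 : K)^'] --> eval_mpoly h^`M(l) (jet_coef e rho).
    rewrite -Qd; apply: (continuous_cvg _ (Qc l _)); apply: cvg_to_pair; first exact: cvg_cst.
    have yc : {for 0, continuous (fun z => jet_coef (y z) rho)}.
      by apply: differentiable_continuous; exact: differentiable_jet_coef.
    by have := continuous_cvg (dnbhs_filter _) yc sh; rewrite y0.
  have sum_lim := @cvg_bigsum _ K _ _ (dnbhs_filter (0 : K)) _ (index_enum 'I_n)
    _ _ (fun l => cvgM (FF := dnbhs_filter _) (yqE rho l) (Qlim l)).
  rewrite /differential_form; apply: (cvg_near_eq sum_lim); move: yX'.
  apply: filterS => t /XP [_ _ yth].
  transitivity (t^-1 * (eval_mpoly h (jet_coef (y (t%:A + 0)) rho) -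
    eval_mpoly h (jet_coef e rho))); last by rewrite yth eh subrr mulr0.
  by rewrite QE mulr_sumr; apply: eq_bigr => l _; rewrite /= mulrA.
have /XP [e0 er eh] := Xe.
have [w [w0 ws wd]] := implicit_curve hv hi.
pose y (z : K^o) := e + z *: v + w z *: top_jet rho (delta_mx 0 i).
have y0 : y 0 = e by rewrite /y w0 !scale0r !addr0.
have y_diff z : differentiable w z -> differentiable y z.
  move=> wz; apply: differentiableD; last exact: differentiableZl.
  apply: differentiableD; first exact: differentiable_cst.
  exact: differentiableZl.
exists y; split=> //.
  have [dw0 _] := nbhs_singleton ws.
  (* One nonzero coordinate [l] of the top coefficient stays nonzero nearby, which keeps the curve
     away from the vertex of the cone. *)
  have [l el] : exists l, jet_coef e rho 0 l != 0.
    apply/existsP; apply: contraNT er; rewrite negb_exists => /forallP er.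
    by apply/eqP/rowP => l; have /negPn /eqP -> := er l; rewrite mxE.
  have yc : jet_coef (y z) rho 0 l @[z --> nbhs (0 : K^o)] --> jet_coef (y 0) rho 0 l.
    apply: differentiable_continuous; apply: differentiable_mxE.
    by apply: differentiable_jet_coef; exact: y_diff.
  rewrite y0 in yc; 
  have yn : \forall z \near (0 : K^o), jet_coef (y z) rho 0 l != 0.
    exact: near_neq0 yc el.
  near=> z.
  have [dw hz] : differentiable w z /\ eval_mpoly h (jet_coef e rho + z *: jet_coef v rho
      + w z *: delta_mx 0 i) = eval_mpoly h (jet_coef e rho) by near: z.
  have yz : jet_coef (y z) rho 0 l != 0 by near: z.
  split; first exact: y_diff.
  apply/XP; split=> [j jr||].
  - rewrite /y !jet_coefD !jet_coefZ jet_coef_top_jet e0 // v0 // ltn_eqF //.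
    by rewrite !scaler0 !addr0.
  - by apply: contraNneq yz => ->; rewrite mxE.
  - by rewrite /y !jet_coefD !jet_coefZ jet_coef_top_jet eqxx hz.
apply: is_derive_cvg.
have lim : v + (t^-1 *: (w (t *: 1 + 0) - w 0)) *: top_jet rho (delta_mx 0 i)
    @[t --> (0 : K)^'] --> v.
  rewrite -[X in _ --> X](_ : v + 0 *: top_jet rho (delta_mx 0 i) = v); last first.
    by rewrite scale0r addr0.
  apply: cvgD; first exact: cvg_cst.
  by apply: cvgZr_tmp; exact: (is_derive_cvg_to wd).
apply: (cvg_near_congr lim).
have tn0 : \forall t \near (0 : K)^', t != 0 by exact: nbhs_dnbhs_neq.
move: tn0; apply: filterS => t tn0.
have subK (a b : 'M[K]_(rho.+1, n)) : e + a + b - e = a + b.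
  by rewrite addrC -addrA addKr.
rewrite y0 /y w0 subr0 subK addr0 [t%:A]mulr1 scalerDr !scalerA.
by rewrite mulVf // scale1r.
Unshelve. all: by end_near.
Qed.

End TangentSpace.

(** * Consequences of the isolated critical point *)

Section IsolatedCriticalPoint.
Context {K : numClosedFieldType} {n : nat}.
Context (d : nat) (h : {mpoly K[n]}).
Context (n_gt1 : (1 < n)%N) (h_homog : h \is d.-homog).
Context (h_isol : isolated_critical_point h 0).

Lemma eval_mpoly_scale c x : eval_mpoly h (c *: x) = c ^+ d * eval_mpoly h x.
Proof.
rewrite /eval_mpoly /meval -(mmap_dhomog _ _ _ h_homog) /mmap.
apply: eq_bigr => al _; congr (_ * _); apply: eq_bigr => i _.
by rewrite mxE.
Qed.

Lemma eval_mderiv_scale i c x :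
  eval_mpoly h^`M(i) (c *: x) = c ^+ d.-1 * eval_mpoly h^`M(i) x.
Proof.
have hi : h^`M(i) \is d.-1.-homog.
  apply/dhomogP => al; rewrite mcoeff_msupp mcoeff_mderiv => nz.
  suff : mdeg (al + U_(i))%MM = d by rewrite mdegD mdeg1 addn1 => <-.
  move/dhomogP : h_homog; apply; rewrite mcoeff_msupp.
  by apply: contraNneq nz => ->; rewrite mul0rn.
rewrite /eval_mpoly /meval -(mmap_dhomog _ _ _ hi) /mmap.
apply: eq_bigr => al _; congr (_ * _); apply: eq_bigr => j _.
by rewrite mxE.
Qed.

Let i0 : 'I_n := Ordinal (ltnW n_gt1).
Let i1 : 'I_n := Ordinal n_gt1.

Lemma delta_neq0 (i : 'I_n) : (delta_mx 0 i : 'rV[K]_n) != 0.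
Proof.
apply/eqP => /rowP /(_ i) /eqP; rewrite !mxE !eqxx /=; exact/negP/oner_neq0.
Qed.

(** By homogeneity of the partial derivatives all multiples of a critical point are critical, and
    they accumulate at [0]. *)
Lemma not_critical x : x != 0 -> ~ critical_point h x.
Proof.
move=> x0 crit; have [_ isol] := h_isol.
have isol' : \forall t \near (0 : K)^', t *: x + 0 != 0 -> ~ critical_point h (t *: x + 0).
  exact: (@cvg_dnbhs_scale K _ x 0 (fun y => y != 0 -> ~ critical_point h y) isol).
have tn0 : \forall t \near (0 : K)^', t != 0 by exact: nbhs_dnbhs_neq.
have [t [tx t0]] := @filter_ex _ _ (Proper_dnbhs_numFieldType (0 : K)) _ (filterI isol' tn0).
rewrite addr0 scaler_eq0 negb_or t0 x0 in tx; apply: tx => // i.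
by rewrite eval_mderiv_scale crit mulr0.
Qed.

Lemma regular x : x != 0 -> exists i, eval_mpoly h^`M(i) x != 0.
Proof.
move=> /not_critical /existsNP [i hi]; exists i; exact/eqP.
Qed.

(** If [d <= 1], then [d.-1 = 0] and the partial derivatives are invariant even under scaling by
    [0]; they vanish at [0], hence also at a basis vector, which contradicts regularity. *)
Lemma degree_gt1 : (1 < d)%N.
Proof.
rewrite ltnNge; apply/negP => d1; have [i /eqP] := regular (delta_neq0 i0); apply.
have [crit _] := h_isol; have := crit i; rewrite -[X in eval_mpoly _ X](scale0r (delta_mx 0 i0)).
by rewrite eval_mderiv_scale; have -> : d.-1 = 0%N by [lia]; rewrite expr0 mul1r.
Qed.

(** If [h] vanished identically, so would its divided differences off the diagonal and, in the
    limit, its partial derivatives. A nonzero value is normalized to [1] by a [d]-th root. *)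
Lemma milnor_fiber_neq0 : milnor_fiber h !=set0.
Proof.
have d0 : (0 < d)%N by rewrite ltnW // degree_gt1.
have [x hx] : exists x, eval_mpoly h x != 0.
  apply/not_existsP => h0; have {}h0 x : eval_mpoly h x = 0.
    by apply/eqP; apply/negPn/negP/h0.
  have [i /eqP] := regular (delta_neq0 i0); apply.
  set x := delta_mx 0 i0; have [Q [Qc QE <-]] := eval_mpoly_increment h.
  have Qlim : Q i (x, t *: delta_mx 0 i + x) @[t --> (0 : K)^'] --> Q i (x, x).
    apply: (continuous_cvg (dnbhs_filter _) (Qc i _)).
    by apply: cvg_to_pair; [exact: cvg_cst|exact: cvg_dnbhs_scale].
  apply: (cvg_near_eq Qlim).
  have tn0 : \forall t \near (0 : K)^', t != 0 by exact: nbhs_dnbhs_neq.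
  apply: filterS tn0 => t t0; apply: (mulfI t0); rewrite mulr0.
  have := QE x (t *: delta_mx 0 i + x); rewrite !h0 subrr (bigD1 i) //= big1.
    by rewrite addr0 !mxE !eqxx mulr1 addrK => <-.
  by move=> j /negPf ji; rewrite !mxE ji andbF mulr0 add0r subrr mul0r.
exists (d.-root (eval_mpoly h x)^-1 *: x); rewrite /milnor_fiber /=.
by rewrite eval_mpoly_scale rootCK // mulVf.
Qed.

(** [h] is restricted to the affine line [u + s v], which misses the origin as [u] and [v] are
    independent. A root in [s] settles the claim. *)
Lemma cone_minus_origin_neq0 : cone_minus_origin h !=set0.
Proof.
have d0 : (0 < d)%N by rewrite ltnW // degree_gt1.
set u : 'rV[K]_n := delta_mx 0 i0; set v : 'rV[K]_n := delta_mx 0 i1.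
have u0 : u != 0 by exact: delta_neq0.
have v0 : v != 0 by exact: delta_neq0.
have usv0 s : u + s *: v != 0.
  apply/eqP => /rowP /(_ i0) /eqP; rewrite !mxE !eqxx /= mulr0 addr0.
  exact/negP/oner_neq0.
have [hv|hv] := eqVneq (eval_mpoly h v) 0; first by exists v; split=> //; exact/eqP.
pose q := mmap polyC (fun j => (u 0 j)%:P + 'X * (v 0 j)%:P) h.
have qE s : q.[s] = eval_mpoly h (u + s *: v).
  rewrite horner_mmap_polyC; apply: meval_eq => j.
  by rewrite hornerD hornerC hornerM hornerX hornerC !mxE.
have [|sq] := boolP (size q == 1%N); last first.
  have [s /rootP] := @closed_rootP _ q sq; rewrite qE => hs.
  by exists (u + s *: v); split=> //; exact/eqP.
(* Without a root, [h] is a constant [c] on the line, so [h (t u + v) = t ^ d c] for [t != 0];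
   letting [t] tend to [0] gives [h v = 0]. *)
move=> /size_poly1P [c c0 qc]; exfalso; move/eqP: hv; apply.
have lim : eval_mpoly h (t *: u + v) @[t --> (0 : K)^'] --> eval_mpoly h v.
  have hc : {for v, continuous (eval_mpoly h)} by exact: continuous_eval_mpoly.
  exact: (continuous_cvg (dnbhs_filter (0 : K)) hc (@cvg_dnbhs_scale K _ u v)).
have lim0 : t ^+ d * c @[t --> (0 : K)^'] --> (0 : K).
  rewrite -(prednK d0) -[X in _ --> X](mul0r c); apply: cvgM; last exact: cvg_cst.
  have id0 : t @[t --> (0 : K)^'] --> (0 : K) by exact: nbhs_dnbhs.
  elim: d.-1 => [|k IH]; first exact: id0.
  have lim2 := cvgM (FF := dnbhs_filter (0 : K)) id0 IH; rewrite mul0r in lim2.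
  by apply: (cvg_near_congr lim2); apply: nearW => t; rewrite [RHS]exprS.
rewrite -[LHS]subr0; apply: (cvg_near_eq (cvgB lim lim0)).
have tn0 : \forall t \near (0 : K)^', t != 0 by exact: nbhs_dnbhs_neq.
apply: filterS tn0 => t t0; apply/eqP; rewrite subr_eq0; apply/eqP.
have -> : t *: u + v = t *: (u + t^-1 *: v).
  by rewrite scalerDr scalerA mulfV // scale1r.
by rewrite eval_mpoly_scale -qE qc hornerC.
Qed.

End IsolatedCriticalPoint.

(** * The affine bundle *)

Section DifferentiableJets.
Context {K : numClosedFieldType} {V : normedModType K} {n : nat}.

Lemma differentiable_truncation m a (g : V -> 'M[K]_(m.+1, n)) x :
  differentiable g x -> differentiable (fun y => truncation a (g y)) x.
Proof.
move=> dg; apply: differentiable_mx => i l.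
by under eq_fun do rewrite mxE; exact: differentiable_mxE.
Qed.

Lemma differentiable_jet_extension m a (g : V -> 'M[K]_(a.+1, n)) x :
  differentiable g x -> differentiable (fun y => jet_extension m (g y)) x.
Proof.
move=> dg; apply: differentiable_mx => i l.
under eq_fun do rewrite mxE; apply: differentiable_mxE.
exact: differentiable_jet_coef.
Qed.

Lemma differentiable_top_jet rho (w : V -> 'rV[K]_n) x :
  differentiable w x -> differentiable (fun y => top_jet rho (w y)) x.
Proof.
move=> dw; apply: differentiable_mx => i l.
under eq_fun do rewrite mxE; case: (i == ord_max); last exact: differentiable_cst.
exact: differentiable_mxE.
Qed.

Lemma differentiable_mulmxr p q (w : V -> 'rV[K]_p) (J : 'M[K]_(p, q)) x :
  differentiable w x -> differentiable (fun y => w y *m J) x.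
Proof.
move=> dw; apply: differentiable_mx => i l.
under eq_fun do rewrite mxE; apply: (@differentiable_fsum _ _ _ _ K).
move=> k; apply: differentiableM; last exact: differentiable_cst.
exact: differentiable_mxE.
Qed.

Lemma differentiable_differential_form (h : {mpoly K[n]}) (y w : V -> 'rV[K]_n) x :
  differentiable y x -> differentiable w x ->
  differentiable (fun z => differential_form h (y z) (w z) : K) x.
Proof.
move=> dy dw; apply: (@differentiable_fsum _ _ _ _ K) => i; apply: differentiableM.
  exact: differentiable_mxE.
exact: differentiable_eval_mpoly.
Qed.

Lemma differentiable_series_coef m (f : power_series K n)
    (g : V -> 'M[K]_(m.+1, n)) j x :
  differentiable g x -> differentiable (fun y => (series_at_jet f (g y))`_j : K) x.
Proof.
move=> dg; under eq_fun do rewrite series_at_jetE.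
apply: differentiable_coef_mmap => i k.
under eq_fun do rewrite coef_jet_poly; apply: differentiable_mxE.
exact: differentiable_jet_coef.
Qed.

End DifferentiableJets.

Lemma differentiable_fst (K : numFieldType) (V W : normedModType K) (p : V * W) :
  differentiable (fun q : V * W => q.1) p.
Proof. by apply: (@linear_differentiable K (V * W)%type V fst) => q; exact: cvg_fst. Qed.

Lemma differentiable_snd (K : numFieldType) (V W : normedModType K) (p : V * W) :
  differentiable (fun q : V * W => q.2) p.
Proof. by apply: (@linear_differentiable K (V * W)%type W snd) => q; exact: cvg_snd. Qed.

Lemma holomorphic_onT (K : numClosedFieldType) (V W : normedModType K)
    (A : set V) (f : V -> W) :
  (forall x, differentiable f x) -> holomorphic_on A f.
Proof. by move=> df x _; exists f; apply: nearW. Qed.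

Section KernelProjection.
Context {K : numClosedFieldType} {n : nat}.
Context (h : {mpoly K[n]}) (i : 'I_n).

(* The projection onto the kernel of the differential of [h] at [x] along the
   [i]-th coordinate axis. *)
Definition kernel_projection (x w : 'rV[K]_n) : 'rV[K]_n :=
  w - (differential_form h x w / eval_mpoly h^`M(i) x) *: delta_mx 0 i.

(** Acting on row vectors, this matrix inserts a zero in position [i], and its transpose forgets
    coordinate [i]. *)
Definition insert_coord : 'M[K]_(n.-1, n) := row' i 1%:M.

Lemma insert_coordK p (y : 'M[K]_(p, n.-1)) : y *m insert_coord *m insert_coord^T = y.
Proof.
rewrite -mulmxA -[RHS]mulmx1; congr (_ *m _).
apply/matrixP => j k; rewrite !mxE (bigD1 (lift i j)) //= big1 => [|l lj].
  by rewrite !mxE eqxx mul1r addr0 (inj_eq (@lift_inj _ i)) eq_sym.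
by rewrite !mxE eq_sym (negPf lj) mul0r.
Qed.

Lemma delta_insert_coord : (delta_mx 0 i : 'rV[K]_n) *m insert_coord^T = 0.
Proof.
apply/rowP => k; rewrite !mxE (bigD1 i) //= big1 => [|l /negPf li].
  by rewrite !mxE !eqxx mul1r addr0 eq_sym (negPf (neq_lift i k)).
by rewrite mxE li andbF mul0r.
Qed.

Lemma insert_coordKV (w : 'rV[K]_n) :
  w *m insert_coord^T *m insert_coord = w - w 0 i *: delta_mx 0 i.
Proof.
apply/rowP => l; rewrite !mxE.
case: (unliftP i l) => [k ->|->].
  rewrite (bigD1 k) //= big1 => [|k' k'k].
    rewrite !mxE (bigD1 (lift i k)) //= big1 => [|j jk].
      by rewrite !mxE !eqxx eq_sym (negPf (neq_lift i k)) !mulr1 !mulr0 !addr0 subr0.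
    by rewrite !mxE eq_sym (negPf jk) mulr0.
  by rewrite !mxE (inj_eq (@lift_inj _ i)) (negPf k'k) mulr0.
rewrite big1 => [|k _]; first by rewrite !eqxx mulr1 subrr.
by rewrite !mxE eq_sym (negPf (neq_lift i k)) mulr0.
Qed.

Lemma kernel_projection_is_linear x : linear (kernel_projection x).
Proof.
move=> c w w'; rewrite /kernel_projection.
have -> : differential_form h x (c *: w + w') =
    c * differential_form h x w + differential_form h x w'.
  by rewrite differential_formD differential_formZ.
rewrite mulrDl scalerDl scalerBr scalerA mulrA opprD !addrA; congr (_ - _).
by rewrite -!addrA; congr (_ + _); rewrite addrC.
Qed.

Context (x : 'rV[K]_n) (hi : eval_mpoly h^`M(i) x != 0).

Lemma differential_form_kernel_projection w :
  differential_form h x (kernel_projection x w) = 0.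
Proof.
by rewrite differential_formB differential_formZ differential_form_delta divfK ?subrr.
Qed.

(** The projection kills the [i]-th axis, so the other coordinates determine its value: they
    parametrize the hyperplane. *)
Lemma kernel_projectionE w :
  kernel_projection x (w *m insert_coord^T *m insert_coord) = kernel_projection x w.
Proof.
rewrite insert_coordKV /kernel_projection differential_formB differential_formZ.
rewrite differential_form_delta mulrBl mulfK // scalerBl opprB addrA.
by rewrite subrK.
Qed.

Lemma kernel_projectionK (w : 'rV[K]_n.-1) :
  kernel_projection x (w *m insert_coord) *m insert_coord^T = w.
Proof. by rewrite mulmxBl insert_coordK -scalemxAl delta_insert_coord scaler0 subr0. Qed.

End KernelProjection.

Section AffineBundle.
Context {K : numClosedFieldType} {n : nat}.
Context (d m : nat) (h : {mpoly K[n]}) (f F : power_series K n) (rho : nat).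
Context (h_homog : h \is d.-homog).
Context (F0 : forall al, (mdeg al <= d)%N -> F al = 0).
Context (fE : forall al, f al = h@_al + F al).
Context (h_reg : forall x, x != 0 -> exists i, eval_mpoly h^`M(i) x != 0).
Context (d_gt1 : (1 < d)%N) (rho_gt0 : (0 < rho)%N) (drho_le : (d * rho <= m)%N).
Context (a : nat) (ra : (rho <= a)%N) (aN : (a < m - d.-1 * rho)%N).

Local Notation FX := (contact_stratum f m (- rho%:Z)).
Local Notation X := (truncation rho @` FX).
Local Notation B := (truncation a @` FX).
Local Notation E := (truncation a.+1 @` FX).
Local Notation M := (pullback_bundle B (truncation rho) (tangent_bundle X)).
Local Notation next := (next_coef_rhs d m f rho).
Local Notation slope i b := (eval_mpoly h^`M(i) (jet_coef b rho)).

Let am : (a < m)%N.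
Proof. by have [_ le _] := stratum_range d_gt1 rho_gt0 drho_le; exact: ltn_trans le. Qed.

Lemma truncated_stratum_base (b : 'M[K]_(a.+1, n)) : B b -> X (truncation rho b).
Proof. by move=> [g Fg <-]; exists g => //; rewrite truncationK // ltnW. Qed.

Lemma jet_coef_truncation_rho (b : 'M[K]_(a.+1, n)) :
  jet_coef (truncation rho b) rho = jet_coef b rho.
Proof. by rewrite jet_coef_truncation // leqnn. Qed.

Lemma truncated_stratumX e : X e <-> [/\ forall j, (j < rho)%N -> jet_coef e j = 0,
  jet_coef e rho != 0 & eval_mpoly h (jet_coef e rho) = (d * rho == m)%N%:R].
Proof. exact: (truncated_stratum_initialP h_homog F0 fE h_reg). Qed.

Lemma modelP (b : 'M[K]_(a.+1, n)) (v : 'M[K]_(rho.+1, n)) (i : 'I_n) : slope i b != 0 ->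
  M (b, v) <-> [/\ B b, forall j, (j < rho)%N -> jet_coef v j = 0 &
    differential_form h (jet_coef b rho) (jet_coef v rho) = 0].
Proof.
rewrite -jet_coef_truncation_rho => bi; split=> [[/= Bb [/= Xb]]|[Bb v0 hv]].
  by move=> /(tangent_space_jets v truncated_stratumX Xb bi) [].
have Xb := truncated_stratum_base Bb; split=> //; split=> //=.
exact/(tangent_space_jets v truncated_stratumX Xb bi).
Qed.

Lemma next_bundleP (e : 'M[K]_(a.+2, n)) : E e <-> B (truncation a e) /\
  differential_form h (jet_coef e rho) (jet_coef e a.+1) = next (truncation a e).
Proof. by apply: (truncated_stratumS h_homog F0 fE h_reg) => //; rewrite ra. Qed.

(** The new coefficient is a vector of the kernel, with parameter [y], plus the particular solution
    of the affine equation that lies on the [i]-th axis. *)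
Definition affine_chart (i : 'I_n) (b : 'M[K]_(a.+1, n)) (y : 'rV[K]_n.-1) :
    'M[K]_(a.+2, n) :=
  jet_extension a.+1 b +
  top_jet a.+1 (kernel_projection h i (jet_coef b rho) (y *m insert_coord i) +
    (next b / slope i b) *: delta_mx 0 i).

Definition vector_chart (i : 'I_n) (b : 'M[K]_(a.+1, n)) (y : 'rV[K]_n.-1) :
    'M[K]_(rho.+1, n) :=
  top_jet rho (kernel_projection h i (jet_coef b rho) (y *m insert_coord i)).

Lemma jet_coef_affine_chart i b y j :
  jet_coef (affine_chart i b y) j = if j == a.+1 then
    kernel_projection h i (jet_coef b rho) (y *m insert_coord i) +
      (next b / slope i b) *: delta_mx 0 i
  else jet_coef b j.
Proof.
rewrite jet_coefD jet_coef_top_jet jet_coef_extension; case: eqP => [->|ja].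
  by rewrite leqnn jet_coef_gt // add0r.
rewrite addr0; case: ltnP => // aj.
by rewrite jet_coef_gt // ltnW.
Qed.

Lemma truncation_affine_chart i b y : truncation a (affine_chart i b y) = b.
Proof.
apply: jet_coefP => j ja; rewrite jet_coef_truncation // ja jet_coef_affine_chart.
by rewrite ltn_eqF.
Qed.

Lemma affine_chartD i b y z :
  affine_chart i b (y + z) = translate_top (affine_chart i b y) (vector_chart i b z).
Proof.
apply: jet_coefP => j ja; rewrite /translate_top jet_coefD.
have -> : (\matrix_(j' < a.+2, l < n)
    (if j' == ord_max then vector_chart i b z ord_max l else 0)) =
    top_jet a.+1 (jet_coef (vector_chart i b z) rho).
  apply/matrixP => k l; rewrite [LHS]mxE [RHS]mxE.
  by rewrite (jet_coef_ord _ (@ord_max rho)) [row _ _ _ _]mxE.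
rewrite jet_coef_top_jet !jet_coef_affine_chart; case: eqP => _; last by rewrite addr0.
rewrite jet_coef_top_jet eqxx mulmxDl.
have := kernel_projection_is_linear h i (jet_coef b rho) 1 (y *m insert_coord i)
  (z *m insert_coord i); rewrite !scale1r => ->.
by rewrite addrAC.
Qed.

Lemma differentiable_slope i (b : 'M[K]_(a.+1, n)) :
  differentiable (fun b : 'M[K]_(a.+1, n) => slope i b : K) b.
Proof.
apply: differentiable_eval_mpoly; exact: differentiable_jet_coef.
Qed.

Lemma open_slope i : open [set b : 'M[K]_(a.+1, n) | slope i b != 0].
Proof.
rewrite openE => b /= bi.
have lim : slope i y @[y --> nbhs b] --> slope i b.
  exact: (differentiable_continuous (@differentiable_slope i b)).
exact: near_neq0 lim bi.
Qed.

Lemma differentiable_kernel_projection (V : normedModType K) i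
    (b : V -> 'M[K]_(a.+1, n)) (w : V -> 'rV[K]_n) x :
  differentiable b x -> differentiable w x -> slope i (b x) != 0 ->
  differentiable (fun y => kernel_projection h i (jet_coef (b y) rho) (w y)) x.
Proof.
move=> db dw bi; apply: differentiableB => //; apply: differentiableZl.
apply: differentiableM.
  by apply: differentiable_differential_form => //; exact: differentiable_jet_coef.
apply: differentiableV => //; apply: differentiable_eval_mpoly.
exact: differentiable_jet_coef.
Qed.

Lemma differentiable_vector_chart i (p : 'M[K]_(a.+1, n) * 'rV[K]_n.-1) :
  slope i p.1 != 0 -> differentiable (fun q => vector_chart i q.1 q.2) p.
Proof.
move=> pi; apply: differentiable_top_jet; apply: differentiable_kernel_projection => //.
  exact: differentiable_fst.
by apply: differentiable_mulmxr; exact: differentiable_snd.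
Qed.

Lemma differentiable_affine_chart i (p : 'M[K]_(a.+1, n) * 'rV[K]_n.-1) :
  slope i p.1 != 0 -> differentiable (fun q => affine_chart i q.1 q.2) p.
Proof.
have dfst := differentiable_fst p; have dsnd := differentiable_snd p.
move=> pi; apply: differentiableD; first exact: differentiable_jet_extension.
apply: differentiable_top_jet; apply: differentiableD.
  by apply: differentiable_kernel_projection => //; exact: differentiable_mulmxr.
apply: differentiableZl; apply: differentiableM.
  apply: differentiableB; first exact: differentiable_cst.
  by apply: differentiable_series_coef; exact: differentiable_jet_extension.
apply: differentiableV => //; apply: differentiable_eval_mpoly.
exact: differentiable_jet_coef.
Qed.

Lemma near_slope i (p : 'M[K]_(a.+1, n) * 'rV[K]_n.-1) :
  slope i p.1 != 0 -> \forall q \near p, slope i q.1 != 0.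
Proof.
move=> pi; have slope_diff : differentiable (fun q => slope i q.1 : K) p.
  apply: differentiable_eval_mpoly; apply: differentiable_jet_coef.
  exact: differentiable_fst.
have lim : slope i q.1 @[q --> nbhs p] --> slope i p.1.
  exact: (differentiable_continuous slope_diff).
exact: near_neq0 lim pi.
Qed.

(** The inverses of both charts forget coordinate [i] of the top coefficient and are holomorphic
    everywhere; the charts divide by the [i]-th partial derivative and are holomorphic where it is
    nonzero. *)
Lemma affine_bundle_truncation :
  affine_bundle n.-1 E B (truncation a) M translate_top.
Proof.
split.
- by apply: holomorphic_onT => x; exact: differentiable_truncation.
- apply/seteqP; split=> [_ [_ [g Fg <-] <-]|_ [g Fg <-]].
    by exists g => //; rewrite truncationK.
  by exists (truncation a.+1 g); [exists g|rewrite truncationK].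
- by move=> b v [].
move=> b0 Bb0; have /truncated_stratumX [_ + _] := truncated_stratum_base Bb0.
rewrite jet_coef_truncation_rho => /h_reg [i bi0].
(* Only the choice of the axis [i] depends on [b0]; one chart serves all base points whose [i]-th
   partial derivative is nonzero. *)
exists [set b | slope i b != 0], (affine_chart i), (vector_chart i); split.
- by split; first exact: open_slope.
- exists (fun e => (truncation a e, jet_coef e a.+1 *m (insert_coord i)^T)); split.
  + move=> p [[_ pi] _]; exists (fun q => affine_chart i q.1 q.2).
    apply: filterS (near_slope pi) => q qi; split=> //.
    exact: differentiable_affine_chart.
  + apply: holomorphic_onT => x; apply: differentiable_pair.
      exact: differentiable_truncation.
    by apply: differentiable_mulmxr; exact: differentiable_jet_coef.
  + move=> [b y] [[/= Bb bi] _]; rewrite truncation_affine_chart; split.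
      split=> //; apply/next_bundleP; rewrite truncation_affine_chart; split=> //.
      rewrite !jet_coef_affine_chart eqxx ltn_eqF //.
      rewrite differential_formD.
      rewrite differential_form_kernel_projection // add0r.
      by rewrite differential_formZ differential_form_delta divfK.
    rewrite jet_coef_affine_chart eqxx mulmxDl kernel_projectionK -scalemxAl.
    by rewrite delta_insert_coord scaler0 addr0.
  + move=> e [/next_bundleP [Be he] /= ei]; split=> //.
    apply: jet_coefP => j ja; rewrite jet_coef_affine_chart.
    case: eqP => [->|/eqP ja1].
      rewrite kernel_projectionE // /kernel_projection -he jet_coef_truncation // ra.
      by rewrite subrK.
    by rewrite jet_coef_truncation // -ltnS ltn_neqAle ja1 ja.
- by move=> b y _; exact: truncation_affine_chart.
- split; last first.
    move=> b _ c y z; apply: jet_coefP => j _.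
    rewrite jet_coefD jet_coefZ !jet_coef_top_jet.
    case: eqP => _; last by rewrite scaler0 addr0.
    by rewrite mulmxDl -scalemxAl kernel_projection_is_linear.
  exists (fun bv => (bv.1, jet_coef bv.2 rho *m (insert_coord i)^T)); split.
  + move=> p [[_ pi] _]; exists (fun q => (q.1, vector_chart i q.1 q.2)).
    apply: filterS (near_slope pi) => q qi; split=> //.
    apply: differentiable_pair; first exact: differentiable_fst.
    exact: differentiable_vector_chart.
  + apply: holomorphic_onT => x; apply: differentiable_pair.
      exact: differentiable_fst.
    apply: differentiable_mulmxr; apply: differentiable_jet_coef.
    exact: differentiable_snd.
  + move=> [b y] [[/= Bb bi] _]; split.
      split=> //; apply/(modelP _ bi); split=> // [j jr|].
        by rewrite jet_coef_top_jet ltn_eqF.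
      by rewrite jet_coef_top_jet eqxx differential_form_kernel_projection.
    by rewrite jet_coef_top_jet eqxx kernel_projectionK.
  + move=> [b v] [/= Mbv bi]; have /(modelP _ bi) [Bb v0 hv] := Mbv.
    split=> //; congr (_, _); apply: jet_coefP => j jr.
    rewrite jet_coef_top_jet; case: eqP => [->|/eqP jr1].
      by rewrite kernel_projectionE // /kernel_projection hv mul0r scale0r subr0.
    by rewrite v0 // ltn_neqAle jr1.
- by move=> b y z _; exact: affine_chartD.
Qed.

End AffineBundle.

(** * The strata *)

Section RatRange.
Context (m d k : nat) (d_gt0 : (0 < d)%N).

Lemma oppr_ratz (j : nat) : (- j%:Z)%:~R = - j%:R :> rat.
Proof. by rewrite rmorphN /= -pmulrn. Qed.

Lemma le_neg_ratio : (- (m%:R / d%:R) <= (- k%:Z)%:~R :> rat) = (d * k <= m)%N.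
Proof. by rewrite oppr_ratz lerN2 ler_pdivlMr ?ltr0n // -natrM ler_nat mulnC. Qed.

Lemma lt_neg_ratio : (- (m%:R / d%:R) < (- k%:Z)%:~R :> rat) = (d * k < m)%N.
Proof. by rewrite oppr_ratz ltrN2 ltr_pdivlMr ?ltr0n // -natrM ltr_nat mulnC. Qed.

Lemma eq_neg_ratio : (- k%:Z)%:~R = - (m%:R / d%:R) :> rat -> (d * k)%N = m.
Proof.
move=> E; apply/eqP; rewrite eqn_leq -le_neg_ratio E lexx /= leqNgt.
by rewrite -lt_neg_ratio E ltxx.
Qed.

End RatRange.

Lemma biholomorphism_row (K : numClosedFieldType) (n rho : nat)
    (X : set 'M[K]_(rho.+1, n)) (Y : set 'rV[K]_n) :
  (forall e, X e <-> (forall j, (j < rho)%N -> jet_coef e j = 0) /\ Y (jet_coef e rho)) ->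
  biholomorphism X Y (row ord_max).
Proof.
move=> XP.
have rowE (e : 'M[K]_(rho.+1, n)) : row ord_max e = jet_coef e rho.
  by rewrite -(jet_coef_ord _ (@ord_max rho)).
exists (top_jet rho); split.
- apply: holomorphic_onT => e; rewrite (_ : row _ = jet_coef ^~ rho); last exact/funext.
  exact: differentiable_jet_coef.
- by apply: holomorphic_onT => x; exact: differentiable_top_jet.
- move=> e /XP [e0 Ye]; rewrite rowE; split=> //; apply: jet_coefP => j jr.
  rewrite jet_coef_top_jet; case: eqP => [->//|/eqP jr'].
  by rewrite e0 // ltn_neqAle jr'.
- move=> x Yx; rewrite rowE jet_coef_top_jet eqxx; split=> //.
  apply/XP; rewrite jet_coef_top_jet eqxx; split=> // j jr.
  by rewrite jet_coef_top_jet ltn_eqF.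
Qed.

Section ContactStratum.
Context {K : numClosedFieldType} {n : nat}.
Context (d m : nat) (h : {mpoly K[n]}) (f : power_series K n) (rho : nat).
Context (n_gt1 : (1 < n)%N) (h_semi : semihomogeneous d h f).
Context (rho_gt0 : (0 < rho)%N) (drho_le : (d * rho <= m)%N).

Local Notation FX := (contact_stratum f m (- rho%:Z)).
Local Notation X := (truncation rho @` FX).

Let h_homog : h \is d.-homog. Proof. by case: h_semi. Qed.
Let h_isol : isolated_critical_point h 0. Proof. by case: h_semi. Qed.
Let d_gt1 : (1 < d)%N. Proof. exact: degree_gt1 n_gt1 h_homog h_isol. Qed.

Let stratumX e : X e <-> [/\ forall j, (j < rho)%N -> jet_coef e j = 0,
  jet_coef e rho != 0 & eval_mpoly h (jet_coef e rho) = (d * rho == m)%N%:R].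
Proof.
have [_ _ [F [F0 fE]]] := h_semi.
exact: (truncated_stratum_initialP h_homog F0 fE (regular h_homog h_isol)).
Qed.

Lemma stratum_cone : (d * rho < m)%N ->
  biholomorphism X (cone_minus_origin h) (row ord_max).
Proof.
move=> lt; apply: biholomorphism_row => e; rewrite stratumX ltn_eqF //.
by split=> [[e0 /eqP er eh]|[e0 [eh /eqP er]]].
Qed.

Lemma stratum_milnor : (d * rho)%N = m ->
  biholomorphism X (milnor_fiber h) (row ord_max).
Proof.
move=> eqm; apply: biholomorphism_row => e; rewrite stratumX eqm eqxx.
(* The condition that the coefficient of order [rho] is nonzero is automatic here, since [h] takes
   the value [0], not [1], at the origin. *)
split=> [[e0 er eh]|[e0 eh]]; split=> //; apply: contra_eqN eh => /eqP ->.
rewrite -(scale0r (0 : 'rV[K]_n)) (eval_mpoly_scale h_homog) expr0n.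
by rewrite gtn_eqF 1?ltnW // mul0r eq_sym oner_eq0.
Qed.

(** Gives the inclusion of [{0}] in the truncation to order [rho - 1]. A point of the cone or of the
    Milnor fibre is carried to a jet by the inverse biholomorphism. *)
Lemma contact_stratum_neq0 : FX !=set0.
Proof.
suff [_ [g Fg _]] : X !=set0 by exists g.
move: drho_le; rewrite leq_eqVlt => /predU1P [/stratum_milnor|/stratum_cone] [g [_ _ _ gX]].
  by have [x /gX []] := milnor_fiber_neq0 n_gt1 h_homog h_isol; exists (g x).
by have [x /gX []] := cone_minus_origin_neq0 n_gt1 h_homog h_isol; exists (g x).
Qed.

Lemma truncation_pred_stratum : truncation rho.-1 @` FX = [set 0].
Proof.
have [le lt _] := stratum_range d_gt1 rho_gt0 drho_le.
have rm : (rho.-1 <= m)%N by rewrite (leq_trans (leq_pred _)) // (leq_trans le) // ltnW.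
have trunc0 g : FX g -> truncation rho.-1 g = 0.
  move=> Fg; have /stratumX [g0 _ _] : X (truncation rho g) by exists g.
  apply: jet_coefP => j jr; have jrho : (j < rho)%N by rewrite -(prednK rho_gt0) ltnS.
  have := g0 j jrho; rewrite !jet_coef_truncation ?(leq_trans le) ?(ltnW lt) //.
  by rewrite jr ltnW // => ->; rewrite jet_coefE; case: ifP => // _; rewrite row0.
apply/seteqP; split=> [_ [g Fg <-]|_ ->]; first exact: trunc0.
by have [g Fg] := contact_stratum_neq0; exists g => //; exact: trunc0.
Qed.

Lemma stratum_affine_bundle a : (rho < a <= m - d.-1 * rho)%N ->
  affine_bundle n.-1 (truncation a @` FX) (truncation a.-1 @` FX) (truncation a.-1)
    (pullback_bundle (truncation a.-1 @` FX) (truncation rho) (tangent_bundle X))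
    translate_top.
Proof.
have [_ _ [F [F0 fE]]] := h_semi.
case: a => [//|a] /andP[ra aN].
exact: (affine_bundle_truncation h_homog F0 fE (regular h_homog h_isol)).
Qed.

End ContactStratum.

Unset Implicit Arguments.
Set Strict Implicit.

Theorem proposition3p1 (R : realType) (n m d : nat)
    (h : {mpoly R[i][n]}) (f : power_series R[i] n) (p : int) :
  (3 <= n)%N -> (1 <= m)%N -> semihomogeneous d h f ->
  let rho := `|(- p)%R|%N in
  let FX := contact_stratum f m p in
  let X := truncation rho @` FX in
  let in_range := (- (m%:R / d%:R) <= p%:~R :> rat) && (p <= -1) in
  (~~ in_range -> FX = set0) /\
  (in_range ->
     [/\ truncation rho.-1 @` FX = [set 0] /\
         FX = truncation (m - d.-1 * rho) @^-1`
                (truncation (m - d.-1 * rho) @` FX),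
         (- (m%:R / d%:R) < p%:~R :> rat ->
            biholomorphism X (cone_minus_origin h) (row ord_max)) /\
         ((d %| m)%N -> p%:~R = - (m%:R / d%:R) :> rat ->
            biholomorphism X (milnor_fiber h) (row ord_max)) &
         forall a : nat, (rho.+1 <= a <= m - d.-1 * rho)%N ->
           let E := truncation a @` FX in
           let B := truncation a.-1 @` FX in
           affine_bundle n.-1 E B (truncation a.-1)
             (pullback_bundle B (truncation rho) (tangent_bundle X))
             translate_top]).
Proof.
move=> n_gt2 _ h_semi rho FX X in_range.
have n_gt1 : (1 < n)%N by exact: ltnW.
have [h_homog h_isol [F [F0 fE]]] := h_semi.
have d_gt1 := degree_gt1 n_gt1 h_homog h_isol.
have d_gt0 : (0 < d)%N := ltnW d_gt1.
split=> [out|/andP[p_ge p_le]].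
  apply: (contact_stratum_set0 h_homog F0 fE) => k pk k_gt0.
  rewrite ltnNge; apply: contra out => dk_le.
  by rewrite /in_range pk le_neg_ratio // dk_le /=; lia.
(* The bound [p <= -1] makes [- p] positive, so the absolute value in [rho] forgets no sign. *)
have pE : p = - rho%:Z by rewrite /rho; lia.
have rho_gt0 : (0 < rho)%N by rewrite /rho; lia.
rewrite /X /FX; move: p_ge; rewrite pE le_neg_ratio // => drho_le.
split.
- split; first exact: (truncation_pred_stratum n_gt1 h_semi).
  exact: (contact_stratum_truncation h_homog F0 fE).
- split=> [|_ /(eq_neg_ratio d_gt0)]; last exact: (stratum_milnor n_gt1 h_semi).
  by rewrite lt_neg_ratio //; exact: (stratum_cone n_gt1 h_semi).
- by move=> a; exact: (stratum_affine_bundle n_gt1 h_semi).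
Qed.
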